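(* For all unitary modified types $\boldsymbol\mu,\boldsymbol\nu,\boldsymbol\lambda$ there exist polynomials $r_{\boldsymbol\mu,\boldsymbol\nu}^{\boldsymbol\lambda}\in\mathcal{R}_{-q}$, only finitely many nonzero for fixed $\boldsymbol\mu,\boldsymbol\nu$, such that for every integer $n\ge0$, in $Z(\mathbb{Z}U_n(\mathbb{F}_q))$, \[ X_{\boldsymbol\mu,n}X_{\boldsymbol\nu,n}=\sum_{\boldsymbol\lambda}r_{\boldsymbol\mu,\boldsymbol\nu}^{\boldsymbol\lambda}([n]_{-q})\,X_{\boldsymbol\lambda,n}, \] the sum ranging over all unitary modified types.
   Context: $q$ is a fixed prime power and $\sigma(z)=z^q$ on $\mathbb{F}_{q^2}$. $U_n(\mathbb{F}_q)=\{g\in GL_n(\mathbb{F}_{q^2}): g^T\sigma(g)=\mathrm{Id}\}$ is the symmetry group of the Hermitian form $B_n(x,y)=\sum_{i=1}^n x_i\sigma(y_i)$ (here $\sigma(g)$ applies $\sigma$ entrywise). We embed $U_n(\mathbb{F}_q)\subset U_{n+1}(\mathbb{F}_q)$ by $g\mapsto\operatorname{diag}(g,1)$. Elements $g\in U_n(\mathbb{F}_q)$, $g'\in U_{n'}(\mathbb{F}_q)$ are said to have the same (unitary) modified type if for some $N\ge n,n'$ their images in $U_N(\mathbb{F}_q)$ are conjugate in $U_N(\mathbb{F}_q)$; a unitary modified type is an equivalence class under this relation. Its size $|\boldsymbol\mu|$ is $\operatorname{rank}(g-\mathrm{Id})$ for any $g$ in the class. $X_{\boldsymbol\mu,n}$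 is the sum of all elements of $U_n(\mathbb{F}_q)$ of modified type $\boldsymbol\mu$ (zero if none). For $n\in\mathbb{Z}$, $[n]_{-q}=((-q)^n-1)/((-q)-1)$, $[k]_{-q}!=[k]_{-q}\cdots[1]_{-q}$, and $\binom{x}{k}_{-q}=\frac{x(x-[1]_{-q})\cdots(x-[k-1]_{-q})}{(-q)^{k(k-1)/2}[k]_{-q}!}$. $\mathcal{R}_{-q}$ is the set of $\mathbb{Z}[q,q^{-1}]$-linear combinations (in $\mathbb{Q}[x]$) of the $\binom{x}{k}_{-q}$, $k\ge0$. *)

(* Defs.v *)
From HB Require Import structures.
From mathcomp Require Import all_boot all_order all_algebra all_field.
From Stdlib Require Import ClassicalEpsilon.
Set Implicit Arguments. Unset Strict Implicit. Unset Printing Implicit Defensive.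
Import Order.TTheory GRing.Theory Num.Theory.
Local Open Scope ring_scope.

Definition prime_power (q : nat) : Prop :=
  exists p k : nat, prime p /\ (0 < k)%N /\ q = (p ^ k)%N.

Section Unitary.
Variables (q : nat) (F : finFieldType).

Definition sigma_mx n (g : 'M[F]_n) : 'M[F]_n := map_mx (fun z => z ^+ q) g.

Definition unitary n (g : 'M[F]_n) : bool := g^T *m sigma_mx g == 1%:M.

(* the image diag(g, 1) of g : 'M_n in 'M_N (for n <= N) *)
Definition ext_mx n (N : nat) (g : 'M[F]_n) : 'M[F]_N :=
  \matrix_(i < N, j < N)
    match @insub nat (fun k => (k < n)%N) 'I_n i, @insub nat (fun k => (k < n)%N) 'I_n j with
    | Some i', Some j' => g i' j'
    | _, _ => (i == j)%:R
    end.

(* representatives of (unitary) modified types: a size n and a matrix *)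
Definition UT := {n : nat & 'M[F]_n}.
Definition ut_unitary (x : UT) : bool := unitary (projT2 x).

Definition same_mtype (x y : UT) : Prop :=
  ut_unitary x /\ ut_unitary y /\
  exists N : nat, (projT1 x <= N)%N /\ (projT1 y <= N)%N /\
    exists h : 'M[F]_N, unitary h /\
      h *m ext_mx N (projT2 y) = ext_mx N (projT2 x) *m h.

(* Elements of the group algebra of U_n, viewed in Q U_n, are functions
   'M_n -> rat supported on U_n; multiplication is convolution. *)
Definition conv n (f h : 'M[F]_n -> rat) (g : 'M[F]_n) : rat :=
  \sum_(a : 'M[F]_n) \sum_(b : 'M[F]_n | a *m b == g) f a * h b.

(* X_{mu,n}: sum of all elements of U_n of modified type mu (rep. by x) *)
Definition Xsum (n : nat) (x : UT) (g : 'M[F]_n) : rat :=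
  if excluded_middle_informative (unitary g /\ same_mtype (existT _ n g) x)
  then 1 else 0.

End Unitary.

Definition qint (q n : nat) : rat :=
  ((- (q%:R : rat)) ^+ n - 1) / ((- (q%:R : rat)) - 1).
Definition qfact (q k : nat) : rat := \prod_(1 <= i < k.+1) qint q i.
Definition qbinom (q k : nat) : {poly rat} :=
  ((((- (q%:R : rat)) ^+ (k * k.-1)./2) * qfact q k)^-1) *:
    \prod_(i < k) ('X - (qint q i)%:P).

Definition in_Zq (q : nat) (c : rat) : Prop :=
  exists (a : int) (e : nat), c = a%:~R / (q%:R ^+ e).

Definition in_Rq (q : nat) (p : {poly rat}) : Prop :=
  exists (m : nat) (c : nat -> rat),
    (forall k, in_Zq q (c k)) /\ p = \sum_(k < m) c k *: qbinom q k.
Arguments Xsum q {F} n x g.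

(* Main.v *)
Require Import Defs.
From mathcomp Require Import all_boot all_order all_algebra all_field.
From mathcomp Require Import ring zify.
From Stdlib Require Import Classical ClassicalEpsilon.
From Stdlib Require Import FunctionalExtensionality PropExtensionality.
Set Implicit Arguments. Unset Strict Implicit. Unset Printing Implicit Defensive.
Import Order.TTheory GRing.Theory Num.Theory.
Local Open Scope ring_scope.

(* Write [X^h] for the conjugate transpose and [Q = - q].  A unitary [g] is
   [1 + W S W^h] with [W] injective and [S] invertible (Wall's
   parametrization), and its modified type is determined by [S], the Gram
   matrix [W^h W] and the linear relations between the columns of [W].  The last
   two data form the code of [W]; two matrices with the same code become
   conjugate under a unitary group after enlarging [n], a weak form of Witt's
   theorem that follows from an explicit reflection.

   Let [B_n] and [A_n] be the numbers of [y] with [W^h y = v], respectively with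
   also [y^h y = c].  Adding a coordinate gives [B_(n+1) = q^2 B_n] and
   [A_(n+1) = (q + 1) B_n - q A_n], so that [A_n] is a polynomial in [Q ^ n].
   Adding columns one by one, the number of pairs [(W1, W2)] with
   [(1 + W1 S1 W1^h) (1 + W2 S2 W2^h) = g] is a polynomial in [Q ^ n] that
   depends only on the type of [g]; up to a constant it is the structure
   constant.  As a function of [[n]_Q] its values are integers for large [n],
   and by the Pascal rule its coefficients in the basis of Gaussian binomials
   are then in [Z[1/q]].  A product of two elements of given types is
   [1 + W S W^h] for [W = [W1 W2]] of bounded width, so only finitely many types
   occur. *)

(** * Norm and trace over the field with q^2 elements *)

(** [q] is a power of the characteristic, so [z ^+ q] is an iterate of the Frobenius
    automorphism. *)
Lemma exists_frobenius (q : nat) (F : finFieldType) :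
  prime_power q -> #|F| = (q ^ 2)%N ->
  (1 < q)%N /\ exists s : {rmorphism F -> F}, forall z, s z = z ^+ q.
Proof.
move=> [p [k [pr_p [k_gt0 ->]]]] cardF; split.
  by rewrite -(exp1n k) ltn_exp2r // prime_gt1.
have charF : p \in [pchar F] by apply: (card_finPcharP (n := k * 2)); rewrite // expnM.
elim: k {k_gt0 cardF} => [|k [s sE]].
  by exists idfun => z; rewrite expn0 expr1.
exists (pFrobenius_aut charF \o s) => z /=.
by rewrite sE pFrobenius_autE -exprM expnSr.
Qed.

Section FieldFacts.
Variables (q : nat) (F : finFieldType) (s : {rmorphism F -> F}).
Hypothesis q_gt1 : (1 < q)%N.
Hypothesis cardF : #|F| = (q ^ 2)%N.
Hypothesis sE : forall z, s z = z ^+ q.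

Lemma frobK : involutive s.
Proof. by move=> z; rewrite !sE -exprM -[RHS]expf_card cardF. Qed.

Lemma card_frob_fixed : (#|[set c : F | s c == c]| <= q)%N.
Proof.
have nz : 'X^q - 'X != 0 :> {poly F}.
  by rewrite -size_poly_gt0 size_polyDl ?size_polyXn // size_polyN size_polyX.
have := max_poly_roots (rs := enum [set c : F | s c == c]) nz.
rewrite -cardE enum_uniq size_polyDl ?size_polyXn ?size_polyN ?size_polyX //.
apply=> //; apply/allP=> c; rewrite mem_enum inE sE => /eqP cq.
by rewrite rootE !hornerE cq subrr.
Qed.

Lemma card_norm_fiber_le c : (#|[set t : F | (s t * t == c)%R]| <= q.+1)%N.
Proof.
have sz : size ('X^(q.+1) - c%:P : {poly F}) = q.+2 by rewrite size_XnsubC.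
have nz : 'X^(q.+1) - c%:P != 0 :> {poly F} by rewrite -size_poly_gt0 sz.
have := max_poly_roots (rs := enum [set t : F | s t * t == c]) nz.
rewrite -cardE enum_uniq sz ltnS; apply=> //.
apply/allP=> t; rewrite mem_enum inE sE => /eqP tq.
by rewrite rootE !hornerE exprSr tq subrr.
Qed.

(* The q^2 - 1 nonzero elements fall into at most q - 1 fibres of size at most q + 1. *)
Lemma card_norm_fiber c : s c = c -> c != 0 ->
  #|[set t : F | s t * t == c]| = q.+1.
Proof.
move=> sc nzc; apply/eqP; rewrite eqn_leq card_norm_fiber_le leqNgt /=.
apply/negP=> lt_c.
pose Fix := [set c : F | s c == c] :\ 0.
have cFix : (#|Fix| <= q.-1)%N.
  have := card_frob_fixed; rewrite (cardsD1 0) inE rmorph0 eqxx add1n.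
  by case: (q) q_gt1.
have Fc : c \in Fix by rewrite !inE nzc sc eqxx.
have tot : (q ^ 2).-1 = (\sum_(d in Fix) #|[set t : F | (s t * t == d)%R]|)%N.
  rewrite -cardF (cardD1 0) inE /= -sum1_card.
  rewrite (partition_big (fun t => s t * t) (mem Fix)) /=; last first.
    move=> t; rewrite !inE andbT => nzt.
    by rewrite mulf_neq0 ?fmorph_eq0 //= rmorphM /= frobK mulrC.
  apply: eq_bigr => d; rewrite !inE => /andP[nzd _].
  rewrite sum1_card; apply: eq_card => t; rewrite !inE unfold_in /= !inE andbT.
  case: eqP => [->|//]; rewrite ?mulr0 /=; apply/esym/negbTE; by rewrite eq_sym.
have : ((q ^ 2).-1 < q.-1 * q.+1)%N.
  rewrite tot (bigD1 c) //= -addSn.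
  have : (\sum_(i in Fix | i != c) #|[set t | (s t * t)%R == i]| <= #|Fix|.-1 * q.+1)%N.
    rewrite (cardD1 c) Fc /= -sum_nat_const big_mkcond /= [leqRHS]big_mkcond /=.
    apply: leq_sum => d _; rewrite !inE andbC; case: ifP => // _.
    exact: card_norm_fiber_le.
  move=> le1; apply: leq_trans (leq_mul cFix (leqnn _)).
  have Fix_gt0 : (0 < #|Fix|)%N by rewrite (cardD1 c) Fc.
  by rewrite -(prednK Fix_gt0) mulSn; apply: leq_add.
by move: q_gt1; clear; case: q => // m _; rewrite -mulnn; nia.
Qed.

(** If the trace vanished identically, [s] would be negation; [s 1 = 1] then gives [-1 = 1], so [s]
    would fix all [q ^ 2] elements, against [card_frob_fixed]. *)
Lemma exists_trace1 : exists a : F, a + s a = 1.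
Proof.
suff [b nzb] : exists b, b + s b != 0.
  exists (b / (b + s b)); rewrite fmorph_div rmorphD /= frobK (addrC (s b) b).
  by rewrite -mulrDl divff.
apply/existsP; apply: contraT; rewrite negb_exists => /forallP /= tr0.
have sN b : s b = - b by apply/eqP; rewrite -addr_eq0 addrC -[_ == _]negbK tr0.
have : (#|F| <= q)%N.
  apply: leq_trans card_frob_fixed; apply: subset_leq_card.
  apply/subsetP=> b _; rewrite inE sN.
  by have := sN 1; rewrite rmorph1 => e; rewrite -mulN1r -e mul1r.
by rewrite cardF leqNgt -{1}(expn1 q) ltn_exp2l.
Qed.

Lemma exists_normN1 : exists e : F, s e * e = - 1.
Proof.
have nz : (0 < #|[set t : F | (s t * t == -1)%R]|)%N.
  by rewrite card_norm_fiber ?rmorphN1 // oppr_eq0 oner_eq0.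
by have /card_gt0P[e] := nz; rewrite inE => /eqP; exists e.
Qed.

End FieldFacts.

(** * Isometries and a weak Witt theorem *)

Definition adj (F : finFieldType) (s : {rmorphism F -> F}) m n
  (A : 'M[F]_(m, n)) : 'M[F]_(n, m) := (map_mx s A)^T.

Section Hermitian.
Variables (q : nat) (F : finFieldType) (s : {rmorphism F -> F}).
Hypothesis q_gt1 : (1 < q)%N.
Hypothesis cardF : #|F| = (q ^ 2)%N.
Hypothesis sE : forall z, s z = z ^+ q.

Local Notation "A ^h" := (adj s A) (at level 8, format "A ^h").

Lemma adjM m n p (A : 'M[F]_(m, n)) (B : 'M_(n, p)) : (A *m B)^h = B^h *m A^h.
Proof. by rewrite /adj map_mxM trmx_mul. Qed.

Lemma adjK m n (A : 'M[F]_(m, n)) : (A^h)^h = A.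
Proof. by apply/matrixP=> i j; rewrite !mxE (frobK cardF sE). Qed.

Lemma adjD m n (A B : 'M[F]_(m, n)) : (A + B)^h = A^h + B^h.
Proof. by apply/matrixP=> i j; rewrite !mxE rmorphD. Qed.

Lemma adjN m n (A : 'M[F]_(m, n)) : (- A)^h = - A^h.
Proof. by apply/matrixP=> i j; rewrite !mxE rmorphN. Qed.

Lemma adjZ m n c (A : 'M[F]_(m, n)) : (c *: A)^h = s c *: A^h.
Proof. by apply/matrixP=> i j; rewrite !mxE rmorphM. Qed.

Lemma adj1 n : (1%:M : 'M[F]_n)^h = 1%:M.
Proof. by rewrite /adj map_mx1 trmx1. Qed.

Lemma adj0 m n : (0 : 'M[F]_(m, n))^h = 0.
Proof. by rewrite /adj map_mx0 trmx0. Qed.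

Lemma adj_row m n p (A : 'M[F]_(m, n)) (B : 'M_(m, p)) :
  (row_mx A B)^h = col_mx A^h B^h.
Proof. by rewrite /adj map_row_mx tr_row_mx. Qed.

Lemma adj_col m n p (A : 'M[F]_(m, n)) (B : 'M_(p, n)) :
  (col_mx A B)^h = row_mx A^h B^h.
Proof. by rewrite /adj map_col_mx tr_col_mx. Qed.

Lemma adj_pid m n r : (pid_mx r : 'M[F]_(m, n))^h = pid_mx r.
Proof. by rewrite /adj map_pid_mx tr_pid_mx. Qed.

Definition isom m n (J : 'M[F]_(m, n)) := J^h *m J = 1%:M.

Lemma unitaryP n (g : 'M[F]_n) : reflect (isom g) (unitary q g).
Proof.
have -> : unitary q g = ((g^h *m g)^T == 1%:M).
  rewrite /unitary trmx_mul trmxK; congr (_ *m _ == _).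
  by apply/matrixP=> i j; rewrite !mxE sE.
apply: (iffP eqP) => [e|->]; last exact: trmx1.
by rewrite /isom -[LHS]trmxK e trmx1.
Qed.

Lemma isomM m n p (J : 'M[F]_(m, n)) (K : 'M[F]_(n, p)) :
  isom J -> isom K -> isom (J *m K).
Proof.
by rewrite /isom => hJ hK; rewrite adjM mulmxA -(mulmxA K^h) hJ mulmx1 hK.
Qed.

Lemma isom_pid N n : (n <= N)%N -> isom (pid_mx n : 'M[F]_(N, n)).
Proof. by move=> leN; rewrite /isom adj_pid mul_pid_mx !minnn (minn_idPr leN) pid_mx_1. Qed.

Lemma unit_isomV n (h : 'M[F]_n) : isom h -> h *m h^h = 1%:M.
Proof. exact: mulmx1C. Qed.

Lemma isom_full m n (J : 'M[F]_(m, n)) : isom J -> row_full J.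
Proof. by move=> hJ; apply/row_fullP; exists J^h. Qed.

(** Replaces the entrywise definition by an expression in the isometry [pid_mx n], which makes sense
    for any isometry. *)
Lemma ext_mxE N n (g : 'M[F]_n) : (n <= N)%N ->
  ext_mx N g = 1%:M + pid_mx n *m (g - 1%:M) *m (pid_mx n : 'M_(N, n))^h.
Proof.
move=> leN; apply/matrixP=> i j; rewrite /ext_mx adj_pid !mxE.
under eq_bigr => k _ do rewrite !mxE.
case: insubP => [i' lti vi|nlti]; last first.
  rewrite big1 ?addr0 // => k _; rewrite big1 ?mul0r // => l _.
  by rewrite !mxE (negbTE nlti) andbF mul0r.
case: insubP => [j' ltj vj|nltj]; last first.
  rewrite big1 ?addr0 // => k _; rewrite [X in _ * X](_ : _ = 0) ?mulr0 //.
  by rewrite ltn_ord andbT; case: eqP => // e; rewrite -e ltn_ord in nltj.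
rewrite (bigD1 j') //= [X in _ + (_ + X)]big1 ?addr0; last first.
  move=> k nkj; rewrite ltn_ord andbT -vj.
  by rewrite -[_ == _]/(k == j') (negbTE nkj) mulr0.
rewrite -vj eqxx ltn_ord mulr1 (bigD1 i') //= big1 ?addr0; last first.
  move=> k nki; rewrite !mxE lti andbT; case: eqP => [e|]; rewrite ?mul0r //.
  by case/eqP: nki; apply: val_inj; rewrite vi e.
have ij : (i == j) = (i' == j').
  by apply/eqP/eqP=> e; apply: val_inj; [rewrite vi e -vj | move: (vi); rewrite e vj].
have ii : (val i == val i') by apply/eqP; exact: esym vi.
by rewrite !mxE -[nat_of_ord i]/(val i) ii lti ij mul1r addrC subrK.
Qed.

(** The row space of [X] encodes the linear relations between its columns. Its canonical generator
    is square of size [m], so codes live in a finite type that does not depend on [n]. *)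
Definition code n m (X : 'M[F]_(n, m)) : 'M[F]_m * 'M[F]_m :=
  (X^h *m X, <<X>>%MS).

Lemma code_isom N n m (J : 'M[F]_(N, n)) (X : 'M[F]_(n, m)) :
  isom J -> code (J *m X) = code X.
Proof.
move=> hJ; rewrite /code adjM mulmxA -(mulmxA X^h) hJ mulmx1; congr (_, _).
by apply/eq_genmx/eqmxMfull/isom_full.
Qed.

(** With [a + s a = 1] and [s e * e = -1], stack [1 + a K], [e] and [e a K]: the last two blocks
    cancel the terms [1] and [s a * a K^2] of the first, leaving [a K + s a K = K]. *)
Lemma gram_exists k (K : 'M[F]_k) : K^h = K ->
  exists T : 'M[F]_(k + (k + k), k), T^h *m T = K.
Proof.
move=> hK; have [a ha] := exists_trace1 q_gt1 cardF sE.
have [e he] := exists_normN1 q_gt1 cardF sE.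
exists (col_mx (1%:M + a *: K) (col_mx e%:M (e *: (a *: K)))).
rewrite !adj_col !mul_row_col adjD adj1 !adjZ hK.
have -> : e%:M = e *: 1%:M :> 'M[F]_k by rewrite scalemx1.
rewrite adjZ adj1 !(mulmxDl, mulmxDr) !mul1mx !mulmx1.
rewrite -!(scalemxAl, scalemxAr) !scalerA !mul1mx he.
have K_split : K = a *: K + s a *: K by rewrite -scalerDl ha scale1r.
rewrite [RHS]K_split.
apply/matrixP=> i j; rewrite !mxE; ring: he.
Qed.

(* The map is the reflection [1 - D K^-1 D^*] with [D = P' - P]. *)
Lemma isom_swap n l (P P' : 'M[F]_(n, l)) :
  P^h *m P \in unitmx -> P'^h *m P' = P^h *m P -> P'^h *m P = 0 ->
  exists h : 'M[F]_n, [/\ isom h, h *m P = P' & h *m P' = P].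
Proof.
set K := P^h *m P => uK hK' hPP'; pose D := P' - P.
have hPP : P^h *m P' = 0 by rewrite -[LHS]adjK adjM adjK hPP' adj0.
have hK : K^h = K by rewrite adjM adjK.
have hKi : (invmx K)^h = invmx K.
  rewrite -[LHS]mulmx1 -(mulmxV uK) mulmxA -{2}hK -adjM mulmxV // adj1.
  exact: mul1mx.
have DP : D^h *m P = - K by rewrite adjD adjN mulmxDl hPP' mulNmx add0r.
have DP' : D^h *m P' = K by rewrite adjD adjN mulmxDl mulNmx hPP hK' subr0.
have DD : D^h *m D = K + K by rewrite mulmxBr DP DP' opprK.
exists (1%:M - D *m invmx K *m D^h); split.
- rewrite /isom adjD adj1 adjN !adjM adjK hKi mulmxA.
  set R := D *m _ *m _; rewrite mulmxBr !mulmxBl !mul1mx !mulmx1.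
  have -> : R *m R = R + R.
    rewrite /R !mulmxA -(mulmxA _ D^h D) DD mulmxDr -(mulmxA _ _ K) mulVmx //.
    by rewrite mulmx1 !mulmxDl.
  by rewrite opprB addrK subrK.
- by rewrite mulmxBl mul1mx -!mulmxA DP mulmxN mulVmx // mulmxN mulmx1 opprK addrC subrK.
- by rewrite mulmxBl mul1mx -!mulmxA DP' mulVmx // mulmx1 opprB addrC subrK.
Qed.

(* Completing [W] by some [Y] with [W^h Y = 1] and [Y^h Y = 0] makes the Gram
   matrix invertible; both completions are then reflected onto the same matrix
   [T], placed in fresh coordinates. *)
Lemma weak_witt_full n l (W W' : 'M[F]_(n, l)) :
  row_full W -> row_full W' -> W^h *m W = W'^h *m W' ->
  exists m (h : 'M[F]_(n + m)), isom h /\ h *m col_mx W 0 = col_mx W' 0.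
Proof.
(* [Y] is the adjoint of a left inverse of [V]; [T], placed in extra coordinates, cancels its Gram
   matrix. *)
have dual (V : 'M[F]_(n, l)) : row_full V ->
    exists (Y : 'M[F]_(n, l)) (T : 'M[F]_(l + (l + l), l)),
      V^h *m Y = 1%:M /\ Y^h *m Y + T^h *m T = 0.
  case/row_fullP=> B hB; exists B^h.
  have [|T hT] := @gram_exists _ (- (B *m B^h)); first by rewrite adjN adjM adjK.
  by exists T; rewrite -adjM hB adj1 hT adjK subrr.
move=> /dual[Y [T1 [WY YT]]] /dual[Y' [T1' [WY' YT']]] eqG.
set G := W^h *m W in eqG.
have hG : G^h = G by rewrite adjM adjK.
pose K : 'M[F]_(l + l) := block_mx G 1%:M 1%:M 0.
have uK : K \in unitmx.
  suff /mulmx1_unit[] : K *m block_mx 0 1%:M 1%:M (- G) = 1%:M by [].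
  rewrite mulmx_block !mulmx0 !mul0mx !mulmx1 !mul1mx !add0r !addr0 ?mulmxN ?mulmx1 ?subrr.
  by rewrite -scalar_mx_block.
have hK : K^h = K.
  by rewrite /adj map_block_mx tr_block_mx -!/(adj _ _) hG adj0 adj1.
have [T hT] := gram_exists hK.
(* [T1], [T1'] and [T] occupy three disjoint blocks of new coordinates, so [P] and [P'] are both
   orthogonal to [P'']. *)
pose a := (l + (l + l))%N; pose b := ((l + l) + ((l + l) + (l + l)))%N.
exists (a + (a + b))%N.
pose P := col_mx (row_mx W Y) (col_mx (row_mx 0 T1) (col_mx 0 0)) : 'M[F]_(n + (a + (a + b)), l + l).
pose P' := col_mx (row_mx W' Y') (col_mx 0 (col_mx (row_mx 0 T1') 0)) : 'M[F]_(n + (a + (a + b)), l + l).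
pose P'' := col_mx 0 (col_mx 0 (col_mx 0 T)) : 'M[F]_(n + (a + (a + b)), l + l).
have gram (V Z : 'M[F]_(n, l)) (U : 'M[F]_(l + (l + l), l)) : V^h *m V = G -> V^h *m Z = 1%:M ->
    Z^h *m Z + U^h *m U = 0 ->
    (row_mx V Z)^h *m row_mx V Z + (row_mx 0 U)^h *m row_mx 0 U = K.
  move=> VV VZ ZU; rewrite !adj_row !mul_col_row add_block_mx VV VZ adj0 ZU.
  by rewrite !mul0mx !mulmx0 !addr0 -[Z^h *m V]adjK adjM adjK VZ adj1.
have gP : P^h *m P = K.
  by rewrite !adj_col !mul_row_col !adj0 !mul0mx !addr0 gram.
have gP' : P'^h *m P' = K.
  by rewrite !adj_col !mul_row_col !adj0 !mul0mx addr0 add0r gram.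
have gP'' : P''^h *m P'' = K.
  by rewrite !adj_col !mul_row_col !adj0 !mul0mx !add0r.
have PP'' : P''^h *m P = 0.
  by rewrite !adj_col !mul_row_col !adj0 !mul0mx !mulmx0 !addr0.
have P'P'' : P''^h *m P' = 0.
  by rewrite !adj_col !mul_row_col !adj0 !mul0mx !mulmx0 !addr0.
have [||//|h1 [h1i h1P _]] := @isom_swap _ _ P P''; rewrite ?gP ?gP'' //.
have [||//|h2 [h2i _ h2P']] := @isom_swap _ _ P' P''; rewrite ?gP' ?gP'' //.
exists (h2 *m h1); split; first exact: isomM.
have cutW : col_mx W 0 = P *m col_mx 1%:M 0.
  by rewrite !mul_col_mx !mul_row_col !mulmx1 !mulmx0 !mul0mx !addr0 !col_mx0.
have cutW' : col_mx W' 0 = P' *m col_mx 1%:M 0.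
  by rewrite !mul_col_mx !mul_row_col !mulmx1 !mulmx0 !mul0mx !addr0 !col_mx0.
by rewrite cutW cutW' mulmxA -(mulmxA h2) h1P h2P'.
Qed.

End Hermitian.

(** * Wall's parametrization and stable conjugacy *)

Section Types.
Variables (q : nat) (F : finFieldType) (s : {rmorphism F -> F}).
Hypothesis q_gt1 : (1 < q)%N.
Hypothesis cardF : #|F| = (q ^ 2)%N.
Hypothesis sE : forall z, s z = z ^+ q.

Local Notation "A ^h" := (adj s A) (at level 8, format "A ^h").

(** Reduction to independent columns: inside size [n + n'] both matrices factor through the same
    [row_base V], and a right inverse of it shows that the left factors have equal Gram matrices. *)
Lemma weak_witt n n' l (W : 'M[F]_(n, l)) (W' : 'M[F]_(n', l)) :
  code s W = code s W' ->
  exists N (h : 'M[F]_N), [/\ (n <= N)%N, (n' <= N)%N, isom s h &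
    h *m (pid_mx n *m W) = pid_mx n' *m W'].
Proof.
move=> eqc; pose n0 := (n + n')%N.
have le1 : (n <= n0)%N by rewrite leq_addr.
have le2 : (n' <= n0)%N by rewrite leq_addl.
have [V VE] : exists V : 'M[F]_(n0, l), V = pid_mx n *m W by exists (pid_mx n *m W).
have [V' V'E] : exists V' : 'M[F]_(n0, l), V' = pid_mx n' *m W' by exists (pid_mx n' *m W').
have : code s V = code s V' by rewrite VE V'E !code_isom //; apply: isom_pid.
case=> eqG /genmxP/andP[leV' leV].
have [C' defV'] : exists C', V' = C' *m row_base V.
  by apply/submxP; rewrite eq_row_base.
have defV : V = col_base V *m row_base V by rewrite mulmx_base.
have [R hR] := row_freeP (row_base_free V).
have C'full : row_full C'.
  rewrite /row_full -(mxrankMfree _ (row_base_free V)) -defV'.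
  by rewrite eqn_leq !mxrankS.
have eqGC : (col_base V)^h *m col_base V = C'^h *m C'.
  have -> : col_base V = V *m R by rewrite -[LHS]mulmx1 -hR mulmxA -defV.
  have -> : C' = V' *m R by rewrite defV' -mulmxA hR mulmx1.
  by rewrite !adjM !mulmxA -(mulmxA R^h) eqG mulmxA.
have [m [h [hh hC]]] :=
  weak_witt_full q_gt1 cardF sE (col_base_full V) C'full eqGC.
exists (n0 + m)%N, h.
have embed k (U : 'M[F]_(k, l)) : (k <= n0)%N ->
    pid_mx k *m U = col_mx (pid_mx k *m U : 'M_(n0, l)) 0 :> 'M_(n0 + m, l).
  move=> lek; have -> : pid_mx k = pid_mx n0 *m (pid_mx k : 'M_(n0, k)) :> 'M[F]_(n0 + m, k).
    by rewrite mul_pid_mx !(minn_idPr lek).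
  by rewrite pid_mx_col -mulmxA mul_col_mx mul1mx mul0mx.
split=> //; rewrite ?(leq_trans le1) ?(leq_trans le2) ?leq_addr //.
rewrite !embed // -VE -V'E.
have -> : col_mx V (0 : 'M_(m, l)) = col_mx (col_base V) 0 *m row_base V.
  by rewrite mul_col_mx mul0mx mulmx_base.
have -> : col_mx V' (0 : 'M_(m, l)) = col_mx C' 0 *m row_base V.
  by rewrite mul_col_mx mul0mx -defV'.
by rewrite mulmxA hC.
Qed.

(** For an isometry [J] this is [g] transported to the image of [J], and the identity on the
    orthogonal complement of that image. *)
Definition ext_along n N (J : 'M[F]_(N, n)) (g : 'M[F]_n) : 'M[F]_N :=
  1%:M + J *m (g - 1%:M) *m J^h.

Lemma ext_alongM n N (J : 'M[F]_(N, n)) (g g' : 'M[F]_n) : isom s J ->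
  ext_along J g *m ext_along J g' = ext_along J (g *m g').
Proof.
move=> hJ; rewrite /ext_along mulmxDr mulmx1 mulmxDl mul1mx -!addrA; congr (_ + _).
rewrite -!mulmxA (mulmxA J^h J) hJ mul1mx (mulmxA (g - _)) -!mulmxDr -!mulmxDl.
congr (_ *m (_ *m _)); rewrite mulmxBr mulmx1 !mulmxBl mul1mx.
by apply/matrixP=> i j; rewrite !mxE; ring.
Qed.

Lemma ext_along_adj n N (J : 'M[F]_(N, n)) (g : 'M[F]_n) :
  (ext_along J g)^h = ext_along J g^h.
Proof. by rewrite adjD adj1 !adjM (adjK cardF sE) adjD adjN adj1 mulmxA. Qed.

Lemma ext_along_isom n N (J : 'M[F]_(N, n)) (g : 'M[F]_n) :
  isom s J -> isom s g -> isom s (ext_along J g).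
Proof.
move=> hJ hg; rewrite /isom ext_along_adj ext_alongM // hg.
by rewrite /ext_along subrr mulmx0 mul0mx addr0.
Qed.

Lemma ext_along_mul n N (J : 'M[F]_(N, n)) g : isom s J ->
  ext_along J g *m J = J *m g.
Proof.
move=> hJ; rewrite mulmxDl mul1mx -mulmxA hJ mulmx1 mulmxBr mulmx1.
by rewrite addrC subrK.
Qed.

(** Extending the isometry of [weak_witt] by the identity makes it available in every large size, as
    the comparison of counting polynomials requires. *)
Lemma weak_witt_large n n' l (W : 'M[F]_(n, l)) (W' : 'M[F]_(n', l)) :
  code s W = code s W' ->
  exists N0, [/\ (n <= N0)%N, (n' <= N0)%N & forall N, (N0 <= N)%N ->
    exists2 h : 'M[F]_N, isom s h & h *m (pid_mx n *m W) = pid_mx n' *m W'].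
Proof.
case/weak_witt=> N0 [h [le1 le2 hh hW]]; exists N0; split=> // N leN.
pose J : 'M[F]_(N, N0) := pid_mx N0.
have hJ : isom s J by apply: isom_pid.
exists (ext_along J h); first exact: ext_along_isom.
have pidE k : (k <= N0)%N -> pid_mx k = J *m pid_mx k :> 'M[F]_(N, k).
  by move=> lek; rewrite mul_pid_mx !(minn_idPr lek).
by rewrite !pidE // mulmxA mulmxA ext_along_mul // -!mulmxA hW.
Qed.

Lemma ext_along_rep n N (J : 'M[F]_(N, n)) l (W : 'M[F]_(n, l)) S :
  ext_along J (1%:M + W *m S *m W^h) = 1%:M + (J *m W) *m S *m (J *m W)^h.
Proof. by rewrite /ext_along [X in J *m X]addrC addKr adjM !mulmxA. Qed.

(** An isometry that carries [W'] to [W] conjugates [1 + W' S W'^h] into [1 + W S W^h]. *)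
Lemma same_mtype_of_code n n' l (W : 'M[F]_(n, l)) (W' : 'M[F]_(n', l)) S z z' :
  code s W = code s W' -> isom s z -> isom s z' ->
  z = 1%:M + W *m S *m W^h -> z' = 1%:M + W' *m S *m W'^h ->
  same_mtype q (existT _ n z) (existT _ n' z').
Proof.
move=> /esym/weak_witt[N [h [le1 le2 hh hW]]] hz hz' zE z'E.
split; first exact/(unitaryP sE); split; first exact/(unitaryP sE).
exists N; do 2!split=> //; exists h; split; first exact/(unitaryP sE).
rewrite !(ext_mxE s) //= -!/(ext_along _ _) zE z'E !ext_along_rep.
rewrite mulmxDr mulmxDl mulmx1 mul1mx !mulmxA -(mulmxA h) hW; congr (_ + _).
by rewrite -hW [in RHS]adjM -!mulmxA hh mulmx1.
Qed.

(** For [A = z - 1], unitarity gives [A = - z A^h]. With a rank factorization [A = C R] this shows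
    that [A] factors through [C^h] on the right, hence [R = S C^h]; [S] is invertible because
    [A = C S C^h] has rank equal to its size. *)
Lemma unitary_rep n (z : 'M[F]_n) : isom s z ->
  exists l (W : 'M[F]_(n, l)) (S : 'M[F]_l),
    [/\ row_full W, S \in unitmx & z = 1%:M + W *m S *m W^h].
Proof.
move=> hz; pose A := z - 1%:M; pose C := col_base A; pose R := row_base A.
have [B hB] := row_fullP (col_base_full A).
have AE : A = - (z *m R^h *m C^h).
  have -> : z *m R^h *m C^h = z *m A^h by rewrite -mulmxA -adjM mulmx_base.
  by rewrite adjD adjN adj1 mulmxBr (unit_isomV hz) mulmx1 opprB.
pose S := - (B *m z *m R^h).
have AS : A = C *m S *m C^h.
  have RE : R = S *m C^h.
    rewrite -[LHS]mul1mx -hB -mulmxA mulmx_base.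
    by transitivity (B *m - (z *m R^h *m C^h)); [by rewrite -AE | rewrite mulmxN mulNmx !mulmxA].
  by rewrite -mulmxA -RE mulmx_base.
exists (\rank A), C, S; split; first exact: col_base_full.
  rewrite -row_full_unit /row_full eqn_leq rank_leq_row {1}AS.
  by apply: leq_trans (mxrankM_maxl _ _) (mxrankM_maxr _ _).
by rewrite -AS addrC subrK.
Qed.

(** Conjugation in size [N] turns [W] into [V] with [V S V^h] supported on the image of [J']. A left
    inverse of [V] and the invertibility of [S] then put the columns of [V] in that image, so that
    [V = J' U]. *)
Lemma code_of_same_mtype n n' l (W : 'M[F]_(n, l)) (S : 'M[F]_l) a :
  row_full W -> S \in unitmx ->
  same_mtype q (existT _ n' a) (existT _ n (1%:M + W *m S *m W^h)) ->
  exists2 U : 'M[F]_(n', l), code s U = code s W & a = 1%:M + U *m S *m U^h.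
Proof.
move=> /row_fullP[B hB] uS [_ [_ [N [le1 [le2 [h [/(unitaryP sE) hh]]]]]]].
rewrite /= in le1 le2 *.
rewrite !(ext_mxE s) //= -!/(ext_along _ _) ext_along_rep.
set J : 'M[F]_(N, n) := pid_mx n; set J' : 'M[F]_(N, n') := pid_mx n'.
have hJ : isom s J by apply: isom_pid.
have hJ' : isom s J' by apply: isom_pid.
move=> eqh; pose V := h *m (J *m W).
have VE : J' *m (a - 1%:M) *m J'^h = V *m S *m V^h.
  have := congr1 (mulmx^~ h^h) eqh; rewrite -[RHS]mulmxA (unit_isomV hh) mulmx1.
  rewrite mulmxDr mulmx1 mulmxDl (unit_isomV hh) => /addrI <-.
  by rewrite /V [in RHS]adjM !mulmxA.
have hV : (B *m J^h *m h^h) *m V = 1%:M.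
  by rewrite /V -!mulmxA (mulmxA h^h) hh mul1mx (mulmxA J^h) hJ mul1mx.
set B' := B *m J^h *m h^h in hV.
pose U := (a - 1%:M) *m J'^h *m B'^h *m invmx S.
have VU : V = J' *m U.
  rewrite /U !mulmxA VE -(mulmxA _ V^h) -adjM hV adj1 mulmx1.
  by rewrite mulmxK.
exists U; first by rewrite -(code_isom U hJ') -VU !code_isom.
rewrite VU adjM !mulmxA in VE.
have := congr1 (fun X => J'^h *m X *m J') VE.
rewrite /= !mulmxA hJ' mul1mx -!mulmxA hJ' mulmx1 !mulmxA.
by rewrite mulmx1 => <-; rewrite addrC subrK.
Qed.

End Types.

(** * Counting column extensions *)

Lemma sign_expr_inj (q : nat) : (1 < q)%N -> injective (fun n => (- q%:R : rat) ^+ n).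
Proof.
move=> q_gt1 m n /= /(congr1 Num.norm).
rewrite !normrX normrN normr_nat -!natrX => /eqP.
by rewrite eqr_nat eqn_exp2l // => /eqP.
Qed.

Lemma poly_eq_on_powers (q : nat) (p p' : {poly rat}) N0 : (1 < q)%N ->
  (forall N, (N0 <= N)%N -> p.[(- q%:R) ^+ N] = p'.[(- q%:R) ^+ N]) -> p = p'.
Proof.
move=> q_gt1 eqpp'; apply/eqP; rewrite -subr_eq0; apply: contraT => nz.
have := max_poly_roots (rs := [seq (- q%:R : rat) ^+ N | N <- iota N0 (size (p - p'))]) nz.
rewrite size_map size_iota ltnn; apply.
  apply/allP=> _ /mapP[N Nin ->].
  by rewrite rootE !hornerE eqpp' ?subrr //; move: Nin; rewrite mem_iota => /andP[].
by rewrite map_inj_uniq ?iota_uniq //; apply: sign_expr_inj.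
Qed.

Section Columns.
Variables (q : nat) (F : finFieldType) (s : {rmorphism F -> F}).
Hypothesis q_gt1 : (1 < q)%N.
Hypothesis cardF : #|F| = (q ^ 2)%N.
Hypothesis sE : forall z, s z = z ^+ q.

Local Notation "A ^h" := (adj s A) (at level 8, format "A ^h").
Local Notation Q := (- q%:R : rat).

Definition hnorm n (y : 'cV[F]_n) : F := (y^h *m y) 0 0.

Definition lin_sols n l (X : 'M[F]_(n, l)) (v : 'cV[F]_l) : {set 'cV[F]_n} :=
  [set y | X^h *m y == v].

Definition herm_sols n l (X : 'M[F]_(n, l)) (v : 'cV[F]_l) (c : F) : {set 'cV[F]_n} :=
  [set y in lin_sols X v | hnorm y == c].

Lemma frob_hnorm n (y : 'cV[F]_n) : s (hnorm y) = hnorm y.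
Proof.
transitivity ((y^h *m y)^h 0 0); first by rewrite [RHS]mxE [RHS]mxE.
by rewrite adjM (adjK cardF sE).
Qed.

Definition add_coord n (u : 'cV[F]_n * F) : 'cV[F]_n.+1 :=
  pid_mx n *m u.1 + u.2 *: delta_mx ord_max 0.

Section AddCoord.
Variable n : nat.
Let J : 'M[F]_(n.+1, n) := pid_mx n.
Let e : 'cV[F]_n.+1 := delta_mx ord_max 0.

Let hJ : J^h *m J = 1%:M.
Proof. exact: isom_pid. Qed.

Let hJe : J^h *m e = 0.
Proof.
rewrite adj_pid; apply/matrixP=> i j; rewrite !mxE big1 // => k _; rewrite !mxE.
case: eqP => [e1|]; rewrite ?mul0r //; case: eqP => [e2|]; rewrite ?mulr0 //.
by have := ltn_ord i; rewrite e1 e2 /= ltnn.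
Qed.

Let ehE : e^h = delta_mx 0 ord_max.
Proof.
by apply/matrixP=> i j; rewrite !mxE andbC; case: (_ && _); rewrite (rmorph1, rmorph0).
Qed.

Let hee : e^h *m e = 1%:M.
Proof.
by rewrite ehE mul_delta_mx; apply/matrixP=> i j; rewrite !mxE !ord1.
Qed.

Let heJ : e^h *m J = 0.
Proof. by rewrite -[LHS](adjK cardF sE) adjM (adjK cardF sE) hJe adj0. Qed.

Let hJJ : J *m J^h + e *m e^h = 1%:M.
Proof.
rewrite ehE mul_delta_mx adj_pid mul_pid_mx !minnn.
apply/matrixP=> i j; rewrite !mxE -val_eqE /=.
have [e1|n1] := eqVneq (i : nat) j; last first.
  rewrite (_ : i == j = false) ?add0r; last by apply/negbTE; rewrite -val_eqE.
  rewrite -!val_eqE /=; case: eqP => //= e1; case: eqP => //= e2.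
  by rewrite e1 e2 eqxx in n1.
have -> : i = j by apply: val_inj.
have jm : (j == ord_max) = (j == n :> nat) by rewrite -val_eqE.
rewrite jm andbb eqxx /=; have := ltn_ord j; rewrite ltnS leq_eqVlt.
by case: eqP => [->|_ /= ->]; rewrite ?ltnn ?add0r ?addr0.
Qed.

Lemma add_coord_bij : bijective (@add_coord n).
Proof.
exists (fun y => (J^h *m y, (e^h *m y) 0 0)) => [[y t]|y]; rewrite /add_coord /= -/J -/e.
  rewrite !mulmxDr -!scalemxAr !mulmxA hJ hJe heJ hee mul1mx mul0mx scaler0 addr0 add0r.
  by rewrite !mxE eqxx mulr1.
rewrite -[RHS]mul1mx -hJJ mulmxDl !mulmxA; congr (_ + _).
rewrite -!mulmxA; apply/matrixP=> i j; rewrite !mxE big_ord1 ord1 mulrC.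
by rewrite !mxE.
Qed.

Lemma add_coord_lin l (X : 'M[F]_(n, l)) v (u : 'cV[F]_n * F) :
  (add_coord u \in lin_sols (pid_mx n *m X) v) = (u.1 \in lin_sols X v).
Proof.
rewrite !inE adjM -/J mulmxDr -scalemxAr -!(mulmxA X^h) hJe !mulmx0 scaler0 addr0.
by rewrite (mulmxA J^h) hJ mul1mx.
Qed.

Lemma hnorm_add_coord (u : 'cV[F]_n * F) : hnorm (add_coord u) = hnorm u.1 + s u.2 * u.2.
Proof.
rewrite /hnorm /add_coord -/J -/e adjD adjM adjZ mulmxDl !mulmxDr.
rewrite -!scalemxAl -!scalemxAr -!(mulmxA (u.1)^h) hJe mulmx0 (mulmxA J^h) hJ mul1mx.
rewrite (mulmxA e^h) heJ mul0mx hee !scaler0 addr0 add0r.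
by rewrite !mxE eqxx mulr1.
Qed.
End AddCoord.

Lemma card_lin_sols_add n l (X : 'M[F]_(n, l)) v :
  #|lin_sols (pid_mx n *m X : 'M_(n.+1, l)) v| = (q ^ 2 * #|lin_sols X v|)%N.
Proof.
rewrite -!sum1_card (reindex (@add_coord n)); last exact/onW_bij/add_coord_bij.
rewrite (eq_bigl (fun u => (u.1 \in lin_sols X v) && true)); last first.
  by move=> u; rewrite add_coord_lin andbT.
rewrite -(pair_big (mem (lin_sols X v)) predT (fun _ _ => 1%N)) /=.
rewrite (eq_bigr (fun=> (q ^ 2)%N)) => [|y _]; last by rewrite sum1_card cardF.
by rewrite sum_nat_const mulnC sum1_card.
Qed.

(** Given the first [n] coordinates [y], the last one must have norm [c - hnorm y]: [q + 1] choices
    if this is nonzero, and one choice if it is zero. The term with factor [q] compensates the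
    second case. *)
Lemma card_herm_sols_add n l (X : 'M[F]_(n, l)) v c : s c = c ->
  (#|herm_sols (pid_mx n *m X : 'M_(n.+1, l)) v c| + q * #|herm_sols X v c| =
   q.+1 * #|lin_sols X v|)%N.
Proof.
move=> sc; rewrite -sum1_card (reindex (@add_coord n)); last exact/onW_bij/add_coord_bij.
rewrite (eq_bigl (fun u => (u.1 \in lin_sols X v) && (s u.2 * u.2 == c - hnorm u.1))); last first.
  by move=> u; rewrite inE add_coord_lin hnorm_add_coord [in RHS]eq_sym subr_eq addrC eq_sym.
rewrite -(pair_big_dep (mem (lin_sols X v)) (fun y t => s t * t == c - hnorm y) (fun _ _ => 1%N)) /=.
have -> : (q * #|herm_sols X v c| =
    \sum_(y in lin_sols X v) if hnorm y == c then q else 0)%N.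
  by rewrite -big_mkcondr -sum1_card big_distrr; apply: eq_big => y *; rewrite /= ?muln1 ?inE.
rewrite -big_split mulnC -sum_nat_const /=; apply: eq_bigr => y _.
have -> : (\sum_(t | (s t * t == c - hnorm y)%R) 1)%N = #|[set t | s t * t == c - hnorm y]|.
  by rewrite sum1_card; apply: eq_card => t; rewrite inE.
have [<-|nyc] := eqVneq; last first.
  rewrite addn0 (card_norm_fiber q_gt1 cardF sE) ?rmorphB /= ?frob_hnorm ?sc //.
  by rewrite subr_eq0 eq_sym.
rewrite subrr (_ : [set t | _] = [set 0]) ?cards1 ?add1n //.
by apply/setP=> t; rewrite !inE mulf_eq0 fmorph_eq0 orbb.
Qed.

Lemma pid_mxS N n l (X : 'M[F]_(n, l)) : (n <= N)%N ->
  pid_mx n *m X = pid_mx N *m (pid_mx n *m X : 'M_(N, l)) :> 'M_(N.+1, l).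
Proof. by move=> le; rewrite mulmxA mul_pid_mx !(minn_idPr le). Qed.

Lemma pid_mx_id n l (X : 'M[F]_(n, l)) : pid_mx n *m X = X.
Proof. by rewrite pid_mx_1 mul1mx. Qed.

Lemma card_herm_sols_poly n l (X : 'M[F]_(n, l)) v c :
  exists p : {poly rat}, forall N, (n <= N)%N ->
    (#|herm_sols (pid_mx n *m X : 'M_(N, l)) v c|)%:R = p.[Q ^+ N].
Proof.
have [sc|nsc] := eqVneq (s c) c; last first.
  exists 0 => N _; rewrite horner0; apply/eqP; rewrite pnatr_eq0 cards_eq0.
  apply/eqP/setP=> y; rewrite !inE; apply/negbTE; apply: contra nsc.
  by case/andP=> _ /eqP <-; rewrite frob_hnorm.
have q_neq0 : q%:R != 0 :> rat by rewrite pnatr_eq0 -lt0n ltnW.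
have Qn0 k : Q ^+ k != 0 by rewrite expf_neq0 // oppr_eq0.
(* [a X^2] is the particular solution of the recurrence at [X = Q ^+ N], and [b]
   fits the initial value at [N = n]. *)
pose a : rat := #|lin_sols X v|%:R / q%:R / Q ^+ n ^+ 2.
pose b : rat := (#|herm_sols X v c|%:R - a * Q ^+ n ^+ 2) / Q ^+ n.
exists (a *: 'X^2 + b *: 'X) => N leN.
(* The recurrence for the second count involves the first, so the induction carries both. *)
suff [] : #|lin_sols (pid_mx n *m X : 'M_(N, l)) v|%:R = a * q%:R * (Q ^+ N) ^+ 2
   /\ #|herm_sols (pid_mx n *m X : 'M_(N, l)) v c|%:R = a * (Q ^+ N) ^+ 2 + b * Q ^+ N.
  by move=> _ ->; rewrite !hornerE.
have [k defN] : exists k, N = (n + k)%N by exists (N - n)%N; rewrite subnKC.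
elim: k N leN defN => [|k IH] N leN; rewrite ?addn0 ?addnS => defN.
  rewrite {N leN}defN !pid_mx_id; split.
    by rewrite /a; field; rewrite q_neq0 Qn0.
  by rewrite /b; field; rewrite Qn0.
rewrite {N leN}defN pid_mxS ?leq_addr //.
have [//|linE hermE] := IH (n + k)%N (leq_addr _ _).
split; first by rewrite card_lin_sols_add natrM linE natrX (exprS Q); ring.
have := card_herm_sols_add (pid_mx n *m X : 'M_(n + k, l)) v sc.
move/(congr1 (fun k => k%:R : rat)); rewrite natrD !natrM linE hermE -[q.+1]addn1 natrD.
move/eqP; rewrite -subr_eq0 => /eqP e; apply/eqP; rewrite -subr_eq0; apply/eqP.
by rewrite -[RHS]e (exprS Q); ring.
Qed.

End Columns.

(** * Columns that complete a matrix to a given code *)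

Section CodeCount.
Variables (q : nat) (F : finFieldType) (s : {rmorphism F -> F}).
Hypothesis q_gt1 : (1 < q)%N.
Hypothesis cardF : #|F| = (q ^ 2)%N.
Hypothesis sE : forall z, s z = z ^+ q.

Local Notation "A ^h" := (adj s A) (at level 8, format "A ^h").
Local Notation Q := (- q%:R : rat).

Definition in_span n l (X : 'M[F]_(n, l)) (y : 'cV[F]_n) : bool :=
  [exists t : 'cV_l, y == X *m t].

Lemma in_span_isom N n l (J : 'M[F]_(N, n)) (X : 'M[F]_(n, l)) y :
  isom s J -> in_span (J *m X) (J *m y) = in_span X y.
Proof.
move=> hJ; apply/existsP/existsP=> -[t /eqP e]; exists t; apply/eqP.
  by rewrite -[y]mul1mx -hJ -mulmxA e -mulmxA mulmxA hJ mul1mx.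
by rewrite e mulmxA.
Qed.

Lemma isom_inj N n l (J : 'M[F]_(N, n)) : isom s J ->
  injective (mulmx J : 'M_(n, l) -> 'M_(N, l)).
Proof. by move=> hJ x y e; rewrite -[x]mul1mx -hJ -mulmxA e mulmxA hJ mul1mx. Qed.

(** The span of [J *m X] is the image of the span of [X], so columns inside the span contribute a
    constant as the size grows. *)
Lemma card_in_span N n l (J : 'M[F]_(N, n)) (X : 'M[F]_(n, l))
    (P : pred 'cV[F]_N) (P0 : pred 'cV[F]_n) :
  isom s J -> (forall y, P (J *m y) = P0 y) ->
  #|[set y | in_span (J *m X) y && P y]| = #|[set y | in_span X y && P0 y]|.
Proof.
move=> hJ PE; rewrite -(card_imset _ (@isom_inj _ _ 1 J hJ)).
apply: eq_card => y; rewrite !inE; apply/andP/imsetP.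
  case=> /existsP[t /eqP ->]; rewrite -mulmxA PE => P0y.
  by exists (X *m t); rewrite // inE P0y andbT; apply/existsP; exists t.
by case=> y0; rewrite inE => /andP[y0X P0y] ->; rewrite in_span_isom // PE.
Qed.

(** Its row space is that of [row_mx y X] for every [y] outside the span of [X], since such a [y]
    enters no linear relation. *)
Definition bordered n l (X : 'M[F]_(n, l)) : 'M[F]_(1 + n, 1 + l) :=
  block_mx 1%:M 0 0 X.

Lemma genmx_bordered_isom N n l (J : 'M[F]_(N, n)) (X : 'M[F]_(n, l)) :
  isom s J -> <<bordered (J *m X)>>%MS = <<bordered X>>%MS.
Proof.
move=> hJ; apply: eq_genmx.
have -> : bordered (J *m X) = block_mx 1%:M 0 0 J *m bordered X.
  by rewrite mulmx_block !mulmx0 !mul0mx !mulmx1 !addr0 add0r.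
apply: eqmxMfull; apply/row_fullP; exists (block_mx 1%:M 0 0 J^h).
by rewrite mulmx_block !mulmx0 !mul0mx !mulmx1 !addr0 add0r hJ -scalar_mx_block.
Qed.

(** Some row [u] has [u X = 0] and [u y = 1]. Then [u] and [1 - y u], applied to [row_mx y X],
    produce the rows of [bordered X]. *)
Lemma genmx_row_mx_out n l (X : 'M[F]_(n, l)) y : ~~ in_span X y ->
  <<row_mx y X>>%MS = <<bordered X>>%MS.
Proof.
move=> yX; apply/genmxP/andP; split.
  have -> : row_mx y X = row_mx y 1%:M *m bordered X.
    by rewrite mul_row_block !mulmx1 !mulmx0 mul1mx addr0 add0r.
  exact: submxMl.
have [u [uX uy]] : exists u : 'rV_n, u *m X = 0 /\ u *m y = 1%:M.
  have : ~~ (y^T <= X^T)%MS.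
    apply: contra yX => /submxP[D e]; apply/existsP; exists D^T; apply/eqP.
    by rewrite -[y]trmxK e trmx_mul trmxK.
  rewrite submxE; set C := cokermx _ => /matrix0Pn[i [j]]; rewrite ord1 => nz.
  (* A column of the cokernel of [X^T] on which [y^T] does not vanish, normalised. *)
  exists (((y^T *m C) 0 j)^-1 *: (col j C)^T); split.
    rewrite -scalemxAl -{1}[X]trmxK -trmx_mul colE (mulmxA X^T) (mulmx_coker X^T : _ *m C = 0) mul0mx.
    by rewrite trmx0 scaler0.
  rewrite -scalemxAl -{2}[y]trmxK -trmx_mul colE (mulmxA y^T C) -(colE j (y^T *m C)).
  by move: (y^T *m C) nz => w nz; apply/matrixP=> a b; rewrite !ord1 !mxE mulVf.
have -> : bordered X = col_mx u (1%:M - y *m u) *m row_mx y X.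
  by rewrite mul_col_row uX uy !mulmxBl !mul1mx -!mulmxA uX uy mulmx0 mulmx1 subrr subr0.
exact: submxMl.
Qed.

Lemma code_row_mx n l (X : 'M[F]_(n, l)) (y : 'cV[F]_n) (K : 'M[F]_(1 + l)) :
  ((row_mx y X)^h *m row_mx y X == K) =
  [&& y \in herm_sols s X (dlsubmx K) (ulsubmx K 0 0),
      (dlsubmx K)^h == ursubmx K & X^h *m X == drsubmx K].
Proof.
rewrite adj_row mul_col_row -{1}[K]submxK !inE.
apply/eqP/idP => [/eq_block_mx[<- <- <- <-]|].
  by rewrite adjM (adjK cardF sE) !eqxx.
case/and3P=> /andP[/eqP dl /eqP ul] /eqP ur /eqP dr.
rewrite dl dr -ur -dl adjM (adjK cardF sE); congr block_mx.
by apply/matrixP=> i j; rewrite !ord1.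
Qed.

(** Inside the span the count is the constant [i1]. Outside it the row space is forced, so the code
    condition is membership in [herm_sols] together with [b], which does not involve [y]; [i2]
    removes the solutions inside the span. *)
Lemma card_code_poly n l (X : 'M[F]_(n, l)) (k : 'M[F]_(1 + l) * 'M[F]_(1 + l)) :
  exists p : {poly rat}, forall N, (n <= N)%N ->
    #|[set y | code s (row_mx y (pid_mx n *m X : 'M_(N, l))) == k]|%:R = p.[Q ^+ N].
Proof.
case: k => K R; set v := dlsubmx K; set c := ulsubmx K 0 0.
pose b := [&& v^h == ursubmx K, X^h *m X == drsubmx K & <<bordered X>>%MS == R].
have [p pE] := card_herm_sols_poly q_gt1 cardF sE X v c.
pose i1 := #|[set y | in_span X y && (code s (row_mx y X) == (K, R))]|.
pose i2 := #|[set y | in_span X y && (y \in herm_sols s X v c)]|.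
exists (i1%:R%:P + b%:R%:P * (p - i2%:R%:P)) => N leN.
have hJ : isom s (pid_mx n : 'M[F]_(N, n)) by apply: isom_pid.
set J := pid_mx n in hJ *; set Y := J *m X.
rewrite !hornerE -pE // -/Y.
have -> : i1 = #|[set y | in_span Y y && (code s (row_mx y Y) == (K, R))]|.
  by apply/esym/card_in_span => // y; rewrite -mul_mx_row code_isom.
have -> : i2 = #|[set y | in_span Y y && (y \in herm_sols s Y v c)]|.
  apply/esym/card_in_span => // y.
  rewrite !inE /hnorm /Y !adjM !mulmxA -!(mulmxA _ J^h J) hJ !mulmx1.
  by [].
have -> : #|[set y | code s (row_mx y Y) == (K, R)]| =
  (#|[set y | in_span Y y && (code s (row_mx y Y) == (K, R))]| +
   b * #|[set y | ~~ in_span Y y && (y \in herm_sols s Y v c)]|)%N.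
  rewrite -(cardsID [set y | in_span Y y]); congr (_ + _)%N.
    by apply: eq_card => y; rewrite !inE andbC.
  have YY : Y^h *m Y = X^h *m X by rewrite adjM mulmxA -(mulmxA X^h) hJ mulmx1.
  have codeE y : ~~ in_span Y y ->
      (code s (row_mx y Y) == (K, R)) = (y \in herm_sols s Y v c) && b.
    move=> yY; rewrite xpair_eqE code_row_mx genmx_row_mx_out // genmx_bordered_isom //.
    by rewrite YY -!andbA.
  case: (b) codeE => codeE; rewrite ?mul1n ?mul0n.
    by apply: eq_card => y; rewrite !inE; case: (boolP (in_span Y y)) => //= /codeE ->; rewrite andbT !inE.
  apply: eq_card0 => y; rewrite !inE.
  by case: (boolP (in_span Y y)) => //= /codeE ->; rewrite andbF.
have <- : (#|[set y | in_span Y y && (y \in herm_sols s Y v c)]| +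
   #|[set y | ~~ in_span Y y && (y \in herm_sols s Y v c)]| = #|herm_sols s Y v c|)%N.
  rewrite -[RHS](cardsID [set y | in_span Y y]); congr (_ + _)%N.
    by apply: eq_card => y; rewrite !inE andbC.
  by apply: eq_card => y; rewrite !inE.
by rewrite !natrD natrM; ring.
Qed.

Lemma card_code_unitary n l (h : 'M[F]_n) (X : 'M[F]_(n, l)) k : isom s h ->
  #|[set y : 'cV_n | code s (row_mx y (h *m X)) == k]| =
  #|[set y : 'cV_n | code s (row_mx y X) == k]|.
Proof.
move=> hh; rewrite -[RHS](card_imset _ (@isom_inj _ _ 1 h hh)); apply: eq_card => y.
rewrite inE; apply/idP/imsetP => [cy|[y0]].
  exists (h^h *m y); last by rewrite mulmxA (unit_isomV hh) mul1mx.
  rewrite inE -(code_isom _ hh) mul_mx_row mulmxA (unit_isomV hh) mul1mx.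
  exact: cy.
by rewrite inE => cy0 ->; rewrite -mul_mx_row code_isom.
Qed.

(* By [weak_witt_large] the polynomials attached to two matrices with the same
   code agree at [Q ^+ N] for all large [N]. *)
Lemma single_column l (k : 'M[F]_l * 'M[F]_l) (k' : 'M[F]_(1 + l) * 'M[F]_(1 + l)) :
  exists p : {poly rat}, forall n (X : 'M[F]_(n, l)), code s X = k ->
    #|[set y : 'cV_n | code s (row_mx y X) == k']|%:R = p.[Q ^+ n].
Proof.
case: (excluded_middle_informative (exists n, exists X : 'M[F]_(n, l), code s X = k)); last first.
  by move=> nex; exists 0 => n X cX; case: nex; exists n, X.
case=> n0 [X0 cX0]; have [p pE] := card_code_poly X0 k'.
exists p => n X cX; have [p' p'E] := card_code_poly X k'.
suff -> : p = p' by rewrite -p'E // pid_mx_id.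
have [N0 [le0 le1 wN]] := weak_witt_large q_gt1 cardF sE (etrans cX0 (esym cX)).
apply: (@poly_eq_on_powers q _ _ N0) => // N leN.
rewrite -pE ?(leq_trans le0) // -p'E ?(leq_trans le1) //.
have [h hh <-] := wN N leN; congr (_%:R).
by rewrite (card_code_unitary (pid_mx n0 *m X0) k' hh).
Qed.

Lemma row_mx_assoc n m l (y : 'cV[F]_n) (R : 'M_(n, m)) (X : 'M_(n, l)) :
  row_mx (row_mx y R) X = row_mx y (row_mx R X) :> 'M_(n, 1 + (m + l)).
Proof. by rewrite row_mxA castmx_id. Qed.

(** Induction on [m]: the outermost column [y] is summed first, grouped by the code of the full
    matrix, with multiplicities from [single_column]. The result is a weight [psi] on the codes of
    the remaining columns; weights are polynomials so that [psi] is again admissible. *)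
Lemma columns_poly l m (k : 'M[F]_l * 'M[F]_l)
    (phi : 'M[F]_(m + l) * 'M[F]_(m + l) -> {poly rat}) :
  exists p : {poly rat}, forall n (X : 'M[F]_(n, l)), code s X = k ->
    \sum_(R : 'M[F]_(n, m)) (phi (code s (row_mx R X))).[Q ^+ n] = p.[Q ^+ n].
Proof.
elim: m phi => [|m IH] phi.
  exists (phi k) => n X <-; rewrite (big_pred1 0) => [|R]; last first.
    by apply/esym/eqP/matrixP=> i [].
  by rewrite row_thin_mx.
pose T l' := ('M[F]_l' * 'M[F]_l')%type.
have /fin_all_exists[P PE] (k0 : T (m + l)%N) :=
  fin_all_exists (fun k' : T (1 + (m + l))%N => single_column k0 k').
pose psi k0 : {poly rat} := \sum_(k' : T (1 + (m + l))%N) phi k' * P k0 k'.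
have [p pE] := IH psi; exists p => n X cX; rewrite -(pE n X cX).
rewrite (reindex (fun u : 'cV[F]_n * 'M[F]_(n, m) => row_mx u.1 u.2 : 'M_(n, 1 + m))) /=; last first.
  exists (fun R => (lsubmx R, rsubmx R)) => [[y R] _|R _] /=.
    by rewrite row_mxKl row_mxKr.
  by rewrite hsubmxK.
under eq_bigr => u _ do rewrite row_mx_assoc.
rewrite -(pair_big predT predT (fun (y : 'cV_n) (R : 'M_(n, m)) =>
  (phi (code s (row_mx y (row_mx R X)))).[Q ^+ n])) /= exchange_big /=.
apply: eq_bigr => R _; rewrite horner_sum.
rewrite (partition_big (fun y => code s (row_mx y (row_mx R X))) predT) //=.
apply: eq_bigr => k' _; rewrite hornerM -(PE _ k' n (row_mx R X) erefl) -sum1_card natr_sum mulr_sumr.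
rewrite big_mkcond [RHS]big_mkcond /=; apply: eq_bigr => y _; rewrite inE.
by case: eqP => // ->; rewrite mulr1.
Qed.

End CodeCount.

(** * Structure constants as polynomials in (-q)^n *)

Section Products.
Variables (q : nat) (F : finFieldType) (s : {rmorphism F -> F}).
Hypothesis q_gt1 : (1 < q)%N.
Hypothesis cardF : #|F| = (q ^ 2)%N.
Hypothesis sE : forall z, s z = z ^+ q.

Local Notation "A ^h" := (adj s A) (at level 8, format "A ^h").
Local Notation Q := (- q%:R : rat).

Definition wall n l (S : 'M[F]_l) (W : 'M[F]_(n, l)) : 'M[F]_n :=
  1%:M + W *m S *m W^h.

Lemma wall_gram n l (S : 'M[F]_l) (W : 'M[F]_(n, l)) :
  (wall S W)^h *m wall S W =
  1%:M + W *m (S + S^h + S^h *m (W^h *m W) *m S) *m W^h.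
Proof.
rewrite /wall adjD adj1 !adjM (adjK cardF sE) mulmxDr mulmx1 !mulmxDl mul1mx.
rewrite mulmxDr mulmxDr !mulmxDl !mulmxA -!addrA; congr (_ + _).
by rewrite addrCA.
Qed.

(** The cross term involves [W1] and [W2] only through their Gram matrix, so the product is again in
    Wall form, with width [l1 + l2]. *)
Lemma wall_mul n l1 l2 S1 S2 (W1 : 'M[F]_(n, l1)) (W2 : 'M[F]_(n, l2)) :
  wall S1 W1 *m wall S2 W2 =
  wall (block_mx S1 (S1 *m (W1^h *m W2) *m S2) 0 S2) (row_mx W1 W2).
Proof.
rewrite /wall adj_row mul_row_block mul_row_col mulmx0 addr0.
rewrite mulmxDr mulmx1 !mulmxDl mul1mx -!addrA; congr (_ + (_ + _)).
by rewrite !mulmxA addrC.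
Qed.

Lemma wall_left n' n l (D : 'M[F]_(n', n)) S (W : 'M[F]_(n, l)) :
  wall S (D *m W) - 1%:M = D *m (wall S W - 1%:M) *m D^h.
Proof. by rewrite /wall ![1%:M + _]addrC !addrK adjM !mulmxA. Qed.

Lemma code_eq_left n n' l (W : 'M[F]_(n, l)) (W' : 'M[F]_(n', l)) :
  code s W = code s W' -> exists D, W' = D *m W.
Proof. by case=> _ /genmxP/andP[_ /submxP]. Qed.

Lemma code_mulr n n' l m (W : 'M[F]_(n, l)) (W' : 'M[F]_(n', l)) (E : 'M_(l, m)) :
  code s W = code s W' -> code s (W *m E) = code s (W' *m E).
Proof.
rewrite /code => -[eqG /genmxP/andP[le1 le2]]; rewrite !adjM !mulmxA.
rewrite -(mulmxA E^h) eqG mulmxA; congr (_, _).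
by apply/genmxP; rewrite !submxMr.
Qed.

(** By [wall_gram], unitarity says [W M W^h = 0] with [M] depending on [S] and the Gram matrix;
    multiplying by [D] and [D^h] moves this to [W' = D W]. *)
Lemma wall_isom_code n n' l S (W : 'M[F]_(n, l)) (W' : 'M[F]_(n', l)) :
  code s W = code s W' -> isom s (wall S W) -> isom s (wall S W').
Proof.
move=> eqc; have [D defW'] := code_eq_left eqc; case: eqc => eqG _.
rewrite /isom !wall_gram -eqG; set M := (_ + _ : 'M_l) => /(canRL (addKr _)).
rewrite addNr {1}defW' => e; rewrite defW' adjM !mulmxA -(mulmxA D) -(mulmxA D) e.
by rewrite mulmx0 mul0mx addr0.
Qed.

Definition reps n l (k : 'M[F]_l * 'M[F]_l) S (a : 'M[F]_n) : {set 'M[F]_(n, l)} :=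
  [set W | (code s W == k) && (wall S W == a)].

Lemma code_full n n' l (W : 'M[F]_(n, l)) (W' : 'M[F]_(n', l)) :
  code s W = code s W' -> row_full W -> row_full W'.
Proof.
by case=> _ /genmxP/eqmxP e; rewrite /row_full e.
Qed.

(** Once some [W] represents [a], the others are exactly the [W P] with [P] in [stab], and [stab]
    depends only on the code and on [S]. Writing the size as [c.+1] records that it is nonzero. *)
Lemma card_reps n0 l (W0 : 'M[F]_(n0, l)) S :
  row_full W0 -> S \in unitmx ->
  exists c, forall n (a : 'M[F]_n),
    #|reps (code s W0) S a| = (if reps (code s W0) S a == set0 then 0 else c.+1)%N.
Proof.
move=> fW0 uS; set k := code s W0.
pose stab := [set P : 'M[F]_l |
  ((P^h *m k.1 *m P, <<P>>%MS) == k) && (P *m S *m P^h == S)].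
have stab1 : 1%:M \in stab.
  rewrite inE adj1 !mul1mx !mulmx1 eqxx andbT /k /code /=; apply/eqP; congr (_, _).
  by apply: eq_genmx; apply: eqmx_trans (eqmx_sym (eqmxMfull 1%:M fW0)) _; rewrite mulmx1.
exists #|stab|.-1 => n a; have [->|[W]] := set_0Vmem (reps k S a).
  by rewrite eqxx cards0.
rewrite prednK; last by apply/card_gt0P; exists 1%:M.
case: eqP => [->|_]; rewrite inE // => /andP[/eqP cW /eqP aW].
have fW : row_full W by apply: code_full fW0; rewrite cW.
have [B hB] := row_fullP fW.
have injW : injective (mulmx W : 'M_(l, l) -> _).
  by move=> P P' /(congr1 (mulmx B)); rewrite !mulmxA hB !mul1mx.
rewrite -(card_imset _ injW); apply: eq_card => W1; rewrite inE.
have memW P : (code s (W *m P) == k) && (wall S (W *m P) == a) = (P \in stab).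
  rewrite inE -cW /code /= adjM; congr (_ && _).
    rewrite !mulmxA; congr ((_, _) == _).
    exact/eq_genmx/eqmxMfull.
  rewrite -aW /wall (inj_eq (addrI _)) adjM; apply/eqP/eqP=> [e|e]; last by rewrite -[in RHS]e !mulmxA.
  have := congr1 (fun X => B *m X *m B^h) e.
  rewrite /= !mulmxA hB !mul1mx -!mulmxA -!adjM hB adj1 mulmx1 !mulmxA.
  by rewrite mul1mx.
apply/idP/imsetP=> [|[P Pst ->]]; last by rewrite memW.
move=> W1a; case/andP: (W1a) => /eqP cW1 /eqP aW1.
have fW1 : row_full W1 by apply: code_full fW0; rewrite cW1.
have [B1 hB1] := row_fullP fW1.
(* Obtained by solving [W1 S W1^h = W S W^h] for [W1] with a left inverse [B1] of [W1]. *)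
pose P := S *m W^h *m B1^h *m invmx S.
suff W1E : W1 = W *m P by exists P; rewrite // -memW -W1E.
move: aW1; rewrite -aW => /addrI e.
by rewrite /P !mulmxA -e -(mulmxA _ W1^h) -adjM hB1 adj1 mulmx1 mulmxK.
Qed.

(** Up to the factor [c.+1], a class sum becomes a count of matrices, which can be enumerated column
    by column. *)
Lemma Xsum_reps nx (x : 'M[F]_nx) : unitary q x ->
  exists l (W : 'M[F]_(nx, l)) S c, [/\ S \in unitmx, row_full W &
    forall n (a : 'M[F]_n),
      Xsum q n (existT _ nx x) a * c.+1%:R = #|reps (code s W) S a|%:R].
Proof.
move/(unitaryP sE)=> hx; have [l [W [S [fW uS xE]]]] := unitary_rep hx.
have [c cE] := card_reps fW uS; exists l, W, S, c; split=> // n a.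
rewrite cE /Xsum; case: excluded_middle_informative => [[ua sa]|nsa].
  rewrite mul1r; case: eqP => // r0.
  have [|U cU aU] := @code_of_same_mtype _ _ _ sE _ n _ W S a fW uS; first by rewrite -xE.
  by have := in_set0 U; rewrite -r0 inE cU aU !eqxx.
rewrite mul0r; case: eqP => [//|/eqP/set0Pn[U]]; rewrite inE => /andP[/eqP cU /eqP aU].
case: nsa; have ha : isom s a by rewrite -aU; apply: wall_isom_code (esym cU) _; rewrite /wall -xE.
split; first exact/(unitaryP sE).
exact: (same_mtype_of_code q_gt1 cardF sE cU ha hx (esym aU) xE).
Qed.

Lemma conv_reps n l1 l2 k1 k2 S1 S2 (g : 'M[F]_n) :
  conv (fun a => #|@reps n l1 k1 S1 a|%:R) (fun a => #|@reps n l2 k2 S2 a|%:R) g =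
  \sum_(R : 'M[F]_(n, l1 + l2))
    ([&& code s (lsubmx R) == k1, code s (rsubmx R) == k2 &
         wall S1 (lsubmx R) *m wall S2 (rsubmx R) == g] : nat)%:R.
Proof.
rewrite (reindex (fun u : 'M[F]_(n, l1) * 'M[F]_(n, l2) => row_mx u.1 u.2)) /=; last first.
  exists (fun R => (lsubmx R, rsubmx R)) => [[W1 W2] _|R _] /=.
    by rewrite row_mxKl row_mxKr.
  by rewrite hsubmxK.
under eq_bigr => u _ do rewrite row_mxKl row_mxKr.
rewrite -(pair_big predT predT (fun (W1 : 'M[F]_(n, l1)) (W2 : 'M[F]_(n, l2)) =>
  ([&& code s W1 == k1, code s W2 == k2 & wall S1 W1 *m wall S2 W2 == g] : nat)%:R)) /=.
(* Pairs [(W1, W2)] are grouped by the elements [a] and [b] they represent. *)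
rewrite (partition_big (wall S1) predT) //=; apply: eq_bigr => a _.
under [RHS]eq_bigr => W1 /eqP -> do [].
rewrite (eq_bigr (fun b => #|reps k1 S1 a|%:R * #|reps k2 S2 b|%:R)) //.
rewrite -mulr_sumr -sum1_card natr_sum mulr_suml.
rewrite big_mkcond [RHS]big_mkcond; apply: eq_bigr => W1 _; rewrite inE andbC.
case: eqP => //= _; case: eqP => _ /=; last by rewrite big1.
rewrite mul1r [RHS](partition_big (wall S2) predT) //=.
rewrite big_mkcond; apply: eq_bigr => b _; case: ifP => ab; last first.
  by rewrite big1 // => W2 /eqP ->; rewrite ab andbF.
rewrite -sum1_card natr_sum big_mkcond [RHS]big_mkcond; apply: eq_bigr => W2 _.
by rewrite inE andbC; case: eqP => //= ->; rewrite ab andbT; case: (_ == _).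
Qed.

(** Write [g = wall S V]. Whether [R = row_mx W1 W2] gives a factorization of [g] depends only on
    the code of [row_mx R V], so [columns_poly] counts such [R] over the fixed columns [V]. *)
Lemma conv_poly (x y z : UT F) :
  ut_unitary q x -> ut_unitary q y -> ut_unitary q z ->
  exists p : {poly rat}, forall n (g : 'M[F]_n), same_mtype q (existT _ n g) z ->
    conv (Xsum q n x) (Xsum q n y) g = p.[Q ^+ n].
Proof.
case: x y z => nx x [ny y] [nz z].
move=> /Xsum_reps[l1 [W1 [S1 [c1 [_ _ XE1]]]]] /Xsum_reps[l2 [W2 [S2 [c2 [_ _ XE2]]]]].
move=> /(unitaryP sE) hz; have [l [W [S [fW uS zE]]]] := unitary_rep hz.
set k1 := code s W1 in XE1; set k2 := code s W2 in XE2.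
pose good n (R : 'M[F]_(n, l1 + l2)) (V : 'M[F]_(n, l)) :=
  [&& code s (lsubmx R) == k1, code s (rsubmx R) == k2 &
      wall S1 (lsubmx R) *m wall S2 (rsubmx R) == wall S V].
(* Equal codes give one [D] with [R' = D R] and [V' = D V]. Both sides of the equation minus [1] are
   then multiplied by [D] and [D^h]; the cross Gram block in [wall_mul] is unchanged. *)
have good_code n n' R V R' V' : code s (row_mx R V) = code s (row_mx R' V') ->
    @good n R V -> @good n' R' V'.
  move=> eqc; have [D] := code_eq_left eqc; rewrite mul_mx_row => /eq_row_mx[R'E V'E].
  have sub m (E : 'M_(l1 + l2, m)) : code s (R *m E) = code s (R' *m E).
    have dE n1 (X : 'M_(n1, _)) (Y : 'M_(n1, l)) : X *m E = row_mx X Y *m col_mx E 0.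
      by rewrite mul_row_col mulmx0 addr0.
    by rewrite (dE _ R V) (dE _ R' V'); apply: code_mulr.
  have eqR : code s R = code s R' by have := sub _ 1%:M; rewrite !mulmx1.
  have lE n1 (X : 'M[F]_(n1, l1 + l2)) : lsubmx X = X *m col_mx 1%:M 0.
    by rewrite -{2}[X]hsubmxK mul_row_col mulmx1 mulmx0 addr0.
  have rE n1 (X : 'M[F]_(n1, l1 + l2)) : rsubmx X = X *m col_mx 0 1%:M.
    by rewrite -{2}[X]hsubmxK mul_row_col mulmx1 mulmx0 add0r.
  have gE : (lsubmx R)^h *m rsubmx R = (lsubmx R')^h *m rsubmx R'.
    case: eqR => eqG _; rewrite !lE !rE !adjM !mulmxA.
    by rewrite -(mulmxA _ R^h) eqG !mulmxA.
  case/and3P=> /eqP ck1 /eqP ck2 /eqP eqg; apply/and3P; split.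
  - by rewrite lE -sub -lE ck1.
  - by rewrite rE -sub -rE ck2.
  move: eqg; rewrite !wall_mul -gE !hsubmxK => eqg.
  by apply/eqP/(addIr (- 1%:M)); rewrite R'E V'E !wall_left eqg.
(* The indicator of [good], viewed as a function of the code. *)
pose phi k : {poly rat} := if excluded_middle_informative
  (exists n (R : 'M[F]_(n, l1 + l2)) (V : 'M[F]_(n, l)), code s (row_mx R V) = k /\ good n R V)
  then 1 else 0.
have [p pE] := columns_poly q_gt1 cardF sE (code s W) phi.
have c12 : (c1.+1%:R * c2.+1%:R)%R != 0 :> rat by rewrite mulf_neq0 // pnatr_eq0.
exists ((c1.+1%:R * c2.+1%:R)^-1 *: p) => n g sgz.
have [|V cV gV] := @code_of_same_mtype _ _ _ sE _ n _ W S g fW uS; first by rewrite -zE.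
rewrite hornerZ -(pE n V cV); apply: (mulfI c12); rewrite mulVKf //.
transitivity (conv (fun a => #|@reps n l1 k1 S1 a|%:R) (fun a => #|@reps n l2 k2 S2 a|%:R) g : rat).
  rewrite /conv mulr_sumr; apply: eq_bigr => a _; rewrite mulr_sumr; apply: eq_bigr => b _.
  by rewrite -XE1 -XE2; ring.
rewrite conv_reps; apply: eq_bigr => R _; rewrite gV -/(wall S V) -/(good n R V) /phi.
case: excluded_middle_informative => [[n' [R' [V' [eqc gd]]]]|ngd].
  by rewrite (good_code _ _ _ _ _ _ eqc gd) hornerC.
by rewrite horner0; case: (boolP (good n R V)) => // gd; case: ngd; exists n, R, V.
Qed.

End Products.

(** * Newton expansion in Gaussian binomials *)

Section NewtonBasis.
Variable q : nat.
Hypothesis q_gt1 : (1 < q)%N.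
Local Notation Q := (- q%:R : rat).

Let q_neq0 : q%:R != 0 :> rat.
Proof. by rewrite pnatr_eq0 -lt0n ltnW. Qed.

Let Q_neq0 : Q != 0.
Proof. by rewrite oppr_eq0. Qed.

Let Q1_neq0 : Q - 1 != 0.
Proof. by rewrite -opprD oppr_eq0 natr1 pnatr_eq0. Qed.

Lemma in_Zq_int (a : int) : in_Zq q a%:~R.
Proof. by exists a, 0%N; rewrite expr0 divr1. Qed.

Lemma in_ZqD a b : in_Zq q a -> in_Zq q b -> in_Zq q (a + b).
Proof.
move=> [x [e ->]] [y [f ->]].
exists (x * (q%:Z ^+ f) + y * (q%:Z ^+ e)), (e + f)%N.
rewrite rmorphD !rmorphM !rmorphXn /= -!pmulrn exprD.
by field; rewrite !expf_neq0.
Qed.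

Lemma in_ZqM a b : in_Zq q a -> in_Zq q b -> in_Zq q (a * b).
Proof.
move=> [x [e ->]] [y [f ->]]; exists (x * y), (e + f)%N.
by rewrite rmorphM exprD /=; field; rewrite !expf_neq0.
Qed.

Lemma in_ZqN a : in_Zq q a -> in_Zq q (- a).
Proof. by move=> [x [e ->]]; exists (- x), e; rewrite rmorphN mulNr. Qed.

Lemma in_Zq_sum m (f : nat -> rat) :
  (forall k, (k < m)%N -> in_Zq q (f k)) -> in_Zq q (\sum_(k < m) f k).
Proof.
move=> fZ; elim/big_rec: _ => [|i a _ aZ]; first exact: (in_Zq_int 0).
by apply: in_ZqD aZ; apply: fZ.
Qed.

Lemma in_Zq_Qexp n : in_Zq q (Q ^+ n).
Proof. by exists ((- q%:Z) ^+ n), 0%N; rewrite expr0 divr1 rmorphXn rmorphN /= -pmulrn. Qed.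

Lemma in_Zq_Qexpn n : in_Zq q (Q ^- n).
Proof.
exists ((-1) ^+ n), n; rewrite rmorphXn /= rmorphN1 -[Q]mulN1r exprMn invfM.
by rewrite invr_sign mulrC.
Qed.

Lemma qintS n : qint q n.+1 = Q * qint q n + 1.
Proof. by rewrite /qint exprS; field. Qed.

Lemma qint0 : qint q 0 = 0.
Proof. by rewrite /qint expr0 subrr mul0r. Qed.

Lemma qintE n : 1 + (Q - 1) * qint q n = Q ^+ n.
Proof. by rewrite /qint; field. Qed.

Lemma qintS_neq0 n : qint q n.+1 != 0.
Proof.
rewrite mulf_neq0 ?invr_eq0 // subr_eq0; apply/eqP.
by rewrite -(expr0 Q) => /(sign_expr_inj q_gt1).
Qed.

Definition qdenom k : rat := Q ^+ (k * k.-1)./2 * qfact q k.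

Lemma qdenomS k : qdenom k.+1 = qdenom k * Q ^+ k * qint q k.+1.
Proof.
rewrite /qdenom /qfact big_nat_recr //=.
have -> : (k.+1 * k)./2 = ((k * k.-1)./2 + k)%N.
  by have := binS k 1; rewrite !bin2 bin1.
by rewrite exprD; ring.
Qed.

Lemma qdenom_neq0 k : qdenom k != 0.
Proof.
elim: k => [|k IH]; first by rewrite /qdenom /qfact big_nil mulr1 oner_eq0.
rewrite qdenomS mulf_neq0 ?qintS_neq0 // mulf_neq0 //.
exact: expf_neq0.
Qed.

Lemma horner_qbinom k x :
  (qbinom q k).[x] = (qdenom k)^-1 * \prod_(i < k) (x - qint q i).
Proof.
rewrite /qbinom hornerZ horner_prod; congr (_ * _).
by apply: eq_bigr => i _; rewrite !hornerE.
Qed.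

Lemma qbinom0 x : (qbinom q 0).[x] = 1.
Proof. by rewrite horner_qbinom big_ord0 /qdenom /qfact big_nil /= expr0 !mulr1. Qed.

(** Since [[n+1] - [i+1] = Q ([n] - [i])], both values share the product over [i < k]; what remains
    is [Q^k [n+1] - [n] + [k] = Q^n [k+1]]. *)
Lemma qbinom_pascal k n :
  (qbinom q k.+1).[qint q n.+1] - (qbinom q k.+1).[qint q n] =
  Q ^+ n * Q ^- k * (qbinom q k).[qint q n].
Proof.
rewrite !horner_qbinom qdenomS big_ord_recl [X in _ - _ * X]big_ord_recr /= qint0 subr0.
have -> : \prod_(i < k) (qint q n.+1 - qint q (bump 0 i)) =
          Q ^+ k * \prod_(i < k) (qint q n - qint q i).
  rewrite -[X in Q ^+ X]card_ord -prodr_const -big_split; apply: eq_bigr => i _ /=.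
  by rewrite [bump 0 i]add1n !qintS; ring.
rewrite -(qintE n) !qintS; move: (qintS_neq0 k) (qdenom_neq0 k) (expf_neq0 k Q_neq0).
by rewrite -(qintE k) qintS => nz1 nz2 nz3; field; rewrite nz1 nz2 nz3.
Qed.

Lemma qbinom_Zq k n : in_Zq q (qbinom q k).[qint q n].
Proof.
elim: n k => [|n IH] [|k]; rewrite ?qbinom0; try exact: (in_Zq_int 1).
  rewrite horner_qbinom big_ord_recl qint0 subrr mul0r mulr0; exact: (in_Zq_int 0).
rewrite -[X in in_Zq q X](subrK (qbinom q k.+1).[qint q n]) qbinom_pascal.
by apply: in_ZqD => //; do 2!apply: in_ZqM => //; [apply: in_Zq_Qexp | apply: in_Zq_Qexpn].
Qed.

(** The twisted difference [Q^-n (f(n+1) - f(n))] has coefficients [c (k+1) / Q^k], and induction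
    applies to it. The remaining [c 0] is read off from the value at [n0]. *)
Lemma newton_coef_Zq m (c : nat -> rat) n0 :
  (forall n, (n0 <= n)%N -> in_Zq q (\sum_(k < m) c k * (qbinom q k).[qint q n])) ->
  forall k, (k < m)%N -> in_Zq q (c k).
Proof.
elim: m c => // m IH c cZ.
have cS k : (k < m)%N -> in_Zq q (c k.+1).
  move=> ltk; rewrite -[c _](mulfVK (expf_neq0 k Q_neq0)).
  apply: in_ZqM (in_Zq_Qexp k); move: k ltk; apply: (IH (fun k => c k.+1 / Q ^+ k)) => n len.
  have := in_ZqM (in_Zq_Qexpn n) (in_ZqD (cZ n.+1 (leqW len)) (in_ZqN (cZ n len))).
  rewrite !big_ord_recl !qbinom0 opprD addrACA subrr add0r -sumrB mulr_sumr.
  congr in_Zq; apply: eq_bigr => k _ /=.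
  by rewrite [bump 0 k]add1n -mulrBr qbinom_pascal; field; rewrite !expf_neq0.
case=> [_|k]; last exact: cS.
have := cZ n0 (leqnn _); rewrite big_ord_recl /= qbinom0 mulr1 => sZ.
rewrite -[c 0%N](addrK (\sum_(i < m) c (bump 0 i) * (qbinom q (bump 0 i)).[qint q n0])).
apply: in_ZqD sZ _; apply: in_ZqN.
apply: (in_Zq_sum (f := fun i => c (bump 0 i) * (qbinom q (bump 0 i)).[qint q n0])) => k ltk.
by rewrite [bump 0 k]add1n; apply: in_ZqM (qbinom_Zq _ _); apply: cS.
Qed.

(** Triangularity: [qbinom q m] has degree [m] and leading coefficient [1 / qdenom m]. *)
Lemma qbinom_span m (p : {poly rat}) : (size p <= m)%N ->
  exists c : nat -> rat, p = \sum_(k < m) c k *: qbinom q k.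
Proof.
elim: m p => [|m IH] p.
  by rewrite leqn0 size_poly_eq0 => /eqP ->; exists (fun=> 0); rewrite big_ord0.
move=> szp; pose B : {poly rat} := \prod_(i < m) ('X - (qint q i)%:P).
have BE : B = \prod_(0 <= i < m) ('X - (qint q i)%:P) by rewrite big_mkord.
have szB : size B = m.+1 by rewrite BE size_prod_XsubC size_iota subn0.
have lcB : B`_m = 1.
  have /monicP := monic_prod_XsubC (index_iota 0 m) xpredT (fun i => qint q i).
  by rewrite -BE lead_coefE szB; apply.
have [|c cE] := IH (p - p`_m *: B).
  apply/leq_sizeP => j; rewrite leq_eqVlt => /orP[/eqP <-|ltj].
    by rewrite coefB coefZ lcB mulr1 subrr.
  rewrite coefB coefZ.
  have -> : p`_j = 0 by apply/nth_default/(leq_trans szp).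
  have -> : B`_j = 0 by apply: nth_default; rewrite szB.
  by rewrite mulr0 subrr.
exists (fun k => if k == m then p`_m * qdenom m else c k).
rewrite big_ord_recr /= eqxx /qbinom -/(qdenom m) -/B scalerA mulfK ?qdenom_neq0 //.
rewrite -[LHS](subrK (p`_m *: B)) cE; congr (_ + _); apply: eq_bigr => k _.
by rewrite ltn_eqF.
Qed.

Lemma in_Rq_values (p : {poly rat}) n0 :
  (forall n, (n0 <= n)%N -> in_Zq q p.[qint q n]) -> in_Rq q p.
Proof.
move=> pZ; have [c cE] := qbinom_span (leqnn (size p)).
exists (size p), (fun k => if (k < size p)%N then c k else 0).
split; last by rewrite {1}cE; apply: eq_bigr => k _; rewrite ltn_ord.
move=> k; case: ifP => [ltk|_]; last exact: (in_Zq_int 0).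
apply: (newton_coef_Zq (n0 := n0)) ltk => n len.
have := pZ n len; rewrite {1}cE horner_sum; congr in_Zq.
by apply: eq_bigr => i _; rewrite hornerZ.
Qed.

End NewtonBasis.

(** * Modified types *)

(** Run through the finitely many codes, adding an element with the current code only if it is
    unrelated to those already listed. *)
Lemma finite_representatives (T : eqType) (C : finType) (P : T -> Prop)
    (has_code : T -> C -> Prop) (E : T -> T -> Prop) :
  (forall z w, E z w -> E w z) ->
  (forall z, P z -> exists c, has_code z c) ->
  (forall z z' c, P z -> P z' -> has_code z c -> has_code z' c -> E z z') ->
  exists s : seq T, [/\ forall z, z \in s -> P z,
    forall x0 i j, (i < size s)%N -> (j < size s)%N ->
      E (nth x0 s i) (nth x0 s j) -> i = j &
    forall z, P z -> exists2 w, w \in s & E z w].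
Proof.
move=> symE ex_code codeE.
suff cover (cs : seq C) : exists s : seq T, [/\ forall z, z \in s -> P z,
    forall x0 i j, (i < size s)%N -> (j < size s)%N ->
      E (nth x0 s i) (nth x0 s j) -> i = j &
    forall z c, P z -> c \in cs -> has_code z c -> exists2 w, w \in s & E z w].
  have [s [sP sE cov]] := cover (enum C); exists s; split=> // z Pz.
  by have [c zc] := ex_code z Pz; apply: cov zc; rewrite ?mem_enum.
elim: cs => [|c cs [s [sP sE cov]]]; first by exists [::].
case: (excluded_middle_informative
  (exists z, [/\ P z, has_code z c & forall w, w \in s -> ~ E z w])); last first.
  move=> nex; exists s; split=> // z c' Pz; rewrite inE => /orP[/eqP ->|]; last exact: cov.
  move=> zc; apply: NNPP => ncov; apply: nex; exists z; split=> // w ws Ezw.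
  by apply: ncov; exists w.
case=> z [Pz zc new]; exists (z :: s); split.
- by move=> w; rewrite inE => /orP[/eqP ->|/sP].
- move=> x0 [|i] [|j] //= lti ltj Eij; last by congr _.+1; apply: sE Eij.
    by case: (new _ (mem_nth x0 ltj)).
  by case: (new _ (mem_nth x0 lti)); apply: symE.
- move=> z' c' Pz'; rewrite inE => /orP[/eqP ->|c's] z'c.
    by exists z; [rewrite inE eqxx | apply: codeE z'c zc].
  by have [w ws Ew] := cov _ _ Pz' c's z'c; exists w; rewrite // inE ws orbT.
Qed.

Section ModifiedTypes.
Variables (q : nat) (F : finFieldType) (s : {rmorphism F -> F}).
Hypothesis q_gt1 : (1 < q)%N.
Hypothesis cardF : #|F| = (q ^ 2)%N.
Hypothesis sE : forall z, s z = z ^+ q.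
Local Notation Q := (- q%:R : rat).
Local Notation same := (@same_mtype q F).

Lemma wall_of_same (x z : UT F) : same x z ->
  exists l (W : 'M[F]_(projT1 z, l)) (U : 'M[F]_(projT1 x, l)) S,
    [/\ code s U = code s W, projT2 x = wall s S U & projT2 z = wall s S W].
Proof.
case: x z => nx x [nz z] xz; have [_ [/(unitaryP sE) hz _]] := xz.
have [l [W [S [fW uS zE]]]] := unitary_rep hz.
have [|U cU xE] := @code_of_same_mtype _ _ _ sE _ nx _ W S x fW uS; first by rewrite -zE.
by exists l, W, U, S.
Qed.

Lemma same_of_wall l n n' (W : 'M[F]_(n, l)) (W' : 'M[F]_(n', l)) S z z' :
  code s W = code s W' -> unitary q z -> unitary q z' ->
  z = wall s S W -> z' = wall s S W' -> same (existT _ n z) (existT _ n' z').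
Proof.
by move=> eqc /(unitaryP sE) hz /(unitaryP sE) hz'; apply: same_mtype_of_code.
Qed.

Lemma same_sym x z : same x z -> same z x.
Proof.
move=> xz; have [ux [uz _]] := xz; have [l [W [U [S [cU xE zE]]]]] := wall_of_same xz.
case: x z ux uz xz W U cU xE zE => nx x [nz z] /= ux uz _ W U cU xE zE.
exact: same_of_wall (esym cU) uz ux zE xE.
Qed.

(** Both [x] and [z] are written with the parameters [W], [S] of [y], so their codes agree and no
    common size has to be chosen. *)
Lemma same_trans x y z : same x y -> same y z -> same x z.
Proof.
move=> xy /same_sym zy; have [ux _] := xy; have [uz [uy _]] := zy.
case: x y z xy zy ux uy uz => nx x [ny y] [nz z] xy zy ux uy uz.
have [l [W [S [fW uS yE]]]] := unitary_rep (unitaryP sE _ uy).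
have [|U cU xE] := @code_of_same_mtype _ _ _ sE _ nx _ W S x fW uS; first by rewrite -yE.
have [|V cV zE] := @code_of_same_mtype _ _ _ sE _ nz _ W S z fW uS; first by rewrite -yE.
exact: same_of_wall (etrans cU (esym cV)) ux uz xE zE.
Qed.

(** Provides an element of the type in every size from [projT1 x] on, at which structure constants
    can be evaluated. *)
Lemma same_ext (x : UT F) N : ut_unitary q x -> (projT1 x <= N)%N ->
  same (existT _ N (ext_mx N (projT2 x))) x.
Proof.
case: x => n z uz leN; have hz : isom s z := unitaryP sE _ uz.
have [l [W [S [fW uS zE]]]] := unitary_rep hz.
have hJ : isom s (pid_mx n : 'M[F]_(N, n)) by apply: isom_pid.
apply: (@same_of_wall l _ _ (pid_mx n *m W) W S) => //.
- exact: code_isom.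
- by apply/(unitaryP sE); rewrite (ext_mxE s) //; exact (ext_along_isom cardF sE hJ hz).
- by rewrite (ext_mxE s) // -/(ext_along _ _ _) zE ext_along_rep.
Qed.

Lemma Xsum_eq x x' n (g : 'M[F]_n) : same x x' -> Xsum q n x g = Xsum q n x' g.
Proof.
move=> xx'; rewrite /Xsum.
case: excluded_middle_informative => [[ug gx]|ngx];
  case: excluded_middle_informative => [[ug' gx']|ngx'] //.
  by case: ngx'; split=> //; apply: same_trans xx'.
by case: ngx; split=> //; apply: same_trans (same_sym xx').
Qed.

Lemma Xsum_neq0 n x (g : 'M[F]_n) : Xsum q n x g != 0 ->
  unitary q g /\ same (existT _ n g) x.
Proof. by rewrite /Xsum; case: excluded_middle_informative => //; rewrite eqxx. Qed.

Lemma Xsum_eq1 n x (g : 'M[F]_n) : same (existT _ n g) x -> Xsum q n x g = 1.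
Proof.
move=> gx; rewrite /Xsum; case: excluded_middle_informative => // ngx.
by case: ngx; split=> //; case: gx.
Qed.

Lemma conv_neq0 n (f h : 'M[F]_n -> rat) g : conv f h g != 0 ->
  exists a b, [/\ a *m b = g, f a != 0 & h b != 0].
Proof.
move=> nz; have : [exists a, exists b, [&& a *m b == g, f a != 0 & h b != 0]].
  apply: contraR nz => /existsPn nab; apply/eqP/big1 => a _; apply: big1 => b abg.
  have /existsPn/(_ b) := nab a; rewrite abg /= -negb_or -mulf_eq0.
  by move/negbNE/eqP.
by case/existsP=> a /existsP[b /and3P[/eqP abg fa hb]]; exists a, b.
Qed.

Lemma conv_Xsum_nat n x y (g : 'M[F]_n) :
  exists m : nat, conv (Xsum q n x) (Xsum q n y) g = m%:R.
Proof.
exists (\sum_(a : 'M[F]_n) \sum_(b : 'M[F]_n | a *m b == g)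
  (Xsum q n x a != 0)%R * (Xsum q n y b != 0)%R)%N.
rewrite natr_sum; apply: eq_bigr => a _; rewrite natr_sum; apply: eq_bigr => b _.
have XE u (c : 'M[F]_n) : Xsum q n u c = (Xsum q n u c != 0)%:R.
  by rewrite /Xsum; case: excluded_middle_informative; rewrite ?eqxx ?oner_eq0.
by rewrite natrM -!XE.
Qed.

(** The last clause forces the zero polynomial on types that never occur. Taking functions and a
    predicate as arguments, instead of representatives, makes the choice below depend on modified
    types only. *)
Definition is_structure_poly (X Y : forall n, 'M[F]_n -> rat)
    (Z : forall n, 'M[F]_n -> Prop) (p : {poly rat}) : Prop :=
  [/\ in_Rq q p,
      forall n g, Z n g -> conv (X n) (Y n) g = p.[qint q n] &
      (forall n g, Z n g -> conv (X n) (Y n) g = 0) -> p = 0].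

Lemma exists_structure_poly (x y z : UT F) : exists p,
  is_structure_poly (fun n => Xsum q n x) (fun n => Xsum q n y)
    (fun n g => same (existT _ n g) z) p.
Proof.
case: (excluded_middle_informative (forall n (g : 'M[F]_n), same (existT _ n g) z ->
    conv (Xsum q n x) (Xsum q n y) g = 0)) => [conv0|nconv0].
  exists 0; split=> // [|n g /conv0 ->]; last by rewrite horner0.
  by exists 0%N, (fun=> 0); rewrite big_ord0; split=> // k; apply: (in_Zq_int q 0).
have [n1 [g1 [g1z /eqP nz]]] : exists n (g : 'M[F]_n), same (existT _ n g) z /\
    conv (Xsum q n x) (Xsum q n y) g <> 0.
  apply: NNPP => nex; apply: nconv0 => n g gz; apply: NNPP => nz.
  by apply: nex; exists n, g.
have [a [b [_ /Xsum_neq0[_ [_ [ux _]]] /Xsum_neq0[_ [_ [uy _]]]]]] := conv_neq0 nz.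
have [_ [uz _]] := g1z.
have [p pE] := conv_poly q_gt1 cardF sE ux uy uz.
(* Change of variable: [Q ^+ n = 1 + (Q - 1) * qint q n]. *)
pose f := p \Po ((Q - 1) *: 'X + 1).
have fE n : f.[qint q n] = p.[Q ^+ n].
  by rewrite horner_comp -qintE !hornerE addrC.
exists f; split=> [|n g gz|conv0]; last by rewrite conv0 ?eqxx in nz.
  apply: (in_Rq_values q_gt1 (n0 := projT1 z)) => n len.
  rewrite fE -(pE n (ext_mx n (projT2 z))); last exact: same_ext.
  by have [m ->] := conv_Xsum_nat x y (ext_mx n (projT2 z)); rewrite pmulrn; apply: in_Zq_int.
by rewrite fE; apply: pE.
Qed.

Definition structure_poly (x y z : UT F) : {poly rat} :=
  epsilon (inhabits 0) (is_structure_poly (fun n => Xsum q n x) (fun n => Xsum q n y)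
    (fun n g => same (existT _ n g) z)).

Lemma structure_polyP x y z :
  is_structure_poly (fun n => Xsum q n x) (fun n => Xsum q n y)
    (fun n g => same (existT _ n g) z) (structure_poly x y z).
Proof. exact: epsilon_spec (exists_structure_poly x y z). Qed.

(** By extensionality, representatives of the same types define the same predicate, on which
    [epsilon] returns the same polynomial. *)
Lemma structure_poly_eq x y z x' y' z' : same x x' -> same y y' -> same z z' ->
  structure_poly x y z = structure_poly x' y' z'.
Proof.
have XE u u' : same u u' -> (fun n => Xsum q n u) = (fun n => Xsum q n u').
  move=> uu'; apply: functional_extensionality_dep => n.
  by apply: functional_extensionality_dep => g; apply: Xsum_eq.
move=> /XE Xx /XE Xy zz'.
have ZE : (fun n (g : 'M[F]_n) => same (existT _ n g) z) =
          (fun n (g : 'M[F]_n) => same (existT _ n g) z').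
  apply: functional_extensionality_dep => n; apply: functional_extensionality_dep => g.
  apply: propositional_extensionality; split=> gz; first exact: same_trans zz'.
  exact: same_trans (same_sym zz').
by rewrite /structure_poly Xx Xy ZE.
Qed.

(** By [wall_mul] every product has Wall parameters of the fixed width [l1 + l2]; the code and [S]
    then range over a finite type. *)
Lemma conv_support (x y : UT F) : ut_unitary q x -> ut_unitary q y ->
  exists l, let C := ('M[F]_l * 'M[F]_l * 'M[F]_l)%type in
  forall n (g : 'M[F]_n), conv (Xsum q n x) (Xsum q n y) g != 0 ->
  unitary q g /\ exists (c : C) (V : 'M[F]_(n, l)), code s V = c.1 /\ g = wall s c.2 V.
Proof.
case: x y => nx x [ny y] ux uy.
have [l1 [W1 [S1 [fW1 uS1 xE]]]] := unitary_rep (unitaryP sE _ ux).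
have [l2 [W2 [S2 [fW2 uS2 yE]]]] := unitary_rep (unitaryP sE _ uy).
exists (l1 + l2)%N => C n g /conv_neq0[a [b [<- /Xsum_neq0[ua ax] /Xsum_neq0[ub bY]]]].
split; first by apply/(unitaryP sE)/isomM; apply/(unitaryP sE).
have [|U1 cU1 ->] := @code_of_same_mtype _ _ _ sE _ n _ W1 S1 a fW1 uS1; first by rewrite -xE.
have [|U2 cU2 ->] := @code_of_same_mtype _ _ _ sE _ n _ W2 S2 b fW2 uS2; first by rewrite -yE.
rewrite -!/(wall _ _ _) wall_mul.
by eexists (code s (row_mx U1 U2), _), (row_mx U1 U2).
Qed.

End ModifiedTypes.

(** * The product formula *)

Theorem theorem8p2 (q : nat) (F : finFieldType) :
  prime_power q -> #|F| = (q ^ 2)%N ->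
  exists r : UT F -> UT F -> UT F -> {poly rat},
    (* r depends only on the modified types *)
    (forall x y z x' y' z', same_mtype q x x' -> same_mtype q y y' ->
       same_mtype q z z' -> r x y z = r x' y' z') /\
    (* coefficients lie in R_{-q} *)
    (forall x y z, in_Rq q (r x y z)) /\
    (forall x y, ut_unitary q x -> ut_unitary q y ->
       exists s : seq (UT F),
         (* s: pairwise distinct modified types *)
         (forall z, z \in s -> ut_unitary q z) /\
         (forall i j, (i < size s)%N -> (j < size s)%N ->
            same_mtype q (nth x s i) (nth x s j) -> i = j) /\
         (* only finitely many nonzero coefficients: those of types in s *)
         (forall z, ut_unitary q z -> (forall w, w \in s -> ~ same_mtype q z w) ->
            r x y z = 0) /\
         (* the product formula, for every n >= 0 *)
         (forall (n : nat) (g : 'M[F]_n),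
            conv (Xsum q n x) (Xsum q n y) g =
            \sum_(z <- s) (r x y z).[qint q n] * Xsum q n z g)).
Proof.
move=> q_pp cardF; have [q_gt1 [s sE]] := exists_frobenius q_pp cardF.
have same_symm := same_sym q_gt1 cardF sE.
have same_transi := same_trans q_gt1 cardF sE.
have rP := structure_polyP q_gt1 cardF sE.
exists (structure_poly q (F := F)); split; first exact: structure_poly_eq q_gt1 cardF sE.
split=> [x y z|x y ux uy]; first by case: (rP x y z).
have [l /= supp] := conv_support sE ux uy.
(* The elements with nonzero coefficient in the product; by [supp] finitely many codes cover
   them. *)
pose P (z : UT F) := ut_unitary q z /\
  conv (Xsum q (projT1 z) x) (Xsum q (projT1 z) y) (projT2 z) != 0.
pose has_code (z : UT F) (c : 'M[F]_l * 'M[F]_l * 'M[F]_l) :=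
  exists V : 'M[F]_(projT1 z, l), code s V = c.1 /\ projT2 z = wall s c.2 V.
have [||reps [repsP repsE cov]] :=
    @finite_representatives _ _ P has_code (@same_mtype q F) same_symm.
- by case=> n z [_ /supp[_]].
- move=> [n z] [n' z'] c [uz _] [uz' _] [V [cV zE]] [V' [cV' zE']].
  exact: same_of_wall q_gt1 cardF sE _ _ _ _ _ _ _ _ (etrans cV (esym cV')) uz uz' zE zE'.
have covg n (g : 'M[F]_n) : conv (Xsum q n x) (Xsum q n y) g != 0 ->
    exists2 w, w \in reps & same_mtype q (existT _ n g) w.
  by move=> nz; apply: cov; split=> //; case: (supp n g nz).
exists reps; split=> [z /repsP[]//|]; split; first exact: repsE.
split=> [z uz znew|n g].
  (* A type outside the list has zero coefficient in every size, so the last clause of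
     [is_structure_poly] applies. *)
  have [_ _] := rP x y z; apply=> n g gz; apply/eqP/negPn/negP => /covg[w ws gw].
  exact: znew ws (same_transi _ _ _ (same_symm _ _ gz) gw).
case: (excluded_middle_informative (exists2 w, w \in reps & same_mtype q (existT _ n g) w)).
  case=> w wr gw; rewrite (big_nth x) big_mkord.
  have ltw : (index w reps < size reps)%N by rewrite index_mem.
  (* The listed types are pairwise distinct, so only the term of [w] survives at [g]. *)
  rewrite (bigD1 (Ordinal ltw)) //= nth_index // big1 ?addr0 => [|j nj].
    by have [_ convE _] := rP x y w; rewrite (convE n g gw) (Xsum_eq1 gw) mulr1.
  rewrite (_ : Xsum q n _ g = 0) ?mulr0 //; apply/eqP/negPn/negP => /Xsum_neq0[_ gj].
  case/eqP: nj; apply: val_inj => /=; apply: (repsE x) => //.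
  by rewrite nth_index //; apply: same_transi gw; apply: same_symm.
move=> ncov; have -> : conv (Xsum q n x) (Xsum q n y) g = 0.
  by apply/eqP/negPn/negP => /covg.
rewrite big_seq big1 // => z zr; rewrite (_ : Xsum q n z g = 0) ?mulr0 //.
by apply/eqP/negPn/negP => /Xsum_neq0[_ gz]; apply: ncov; exists z.
Qed.
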